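(* Let $\mathcal F=\mathcal N_1^-/\!\sim$, on which $\mathrm F_{4(-20)}$ acts by $g[X]=[gX]$. Then: (1) the stabilizer of $[P^-]$ is $(\mathrm F_{4(-20)})_{[P^-]}=MAN^+$; (2) $\mathrm F_{4(-20)}/MAN^+\simeq\mathcal F$ (via $g\,MAN^+\mapsto g[P^-]$); (3) $\mathcal F=K\cdot[P^-]$; (4) $\mathcal F\simeq \mathrm{Spin}(9)/\mathrm{Spin}(7)$, where $\mathrm{Spin}(9)=K$ and $\mathrm{Spin}(7)=M$ (via $kM\mapsto k[P^-]$).
   Context: Octonions: $\mathbf O$ is the real division algebra of octonions with standard basis $1=e_0,e_1,\dots,e_7$, conjugation $x\mapsto\overline x$, inner product $(x|y)=\mathrm{Re}(x\overline y)$, and $\mathrm{Im}\,\mathbf O=\mathrm{span}_{\mathbb R}(e_1,\dots,e_7)$. Jordan algebra: for $\xi_i\in\mathbb R$, $x_i\in\mathbf O$ let $$h^1(\xi_1,\xi_2,\xi_3;x_1,x_2,x_3)=\begin{pmatrix}\xi_1&\sqrt{-1}x_3&\sqrt{-1}\,\overline{x_2}\\ \sqrt{-1}\,\overline{x_3}&\xi_2&x_1\\ \sqrt{-1}x_2&\overline{x_1}&\xi_3\end{pmatrix}$$ (entries in $\mathbf O\otimes_{\mathbb R}\mathbb C$). $\mathcal J^1$ is the real vector space of all these matrices, with Jordan product $X\circ Y=\frac12(XY+YX)$, trace $\mathrm{tr}(X)=\xi_1+\xi_2+\xi_3$, bilinear form $(X|Y)=\mathrm{tr}(X\circ Y)=\sum\xi_i\eta_i+2(x_1|y_1)-2(x_2|y_2)-2(x_3|y_3)$.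 For $X=h^1(\xi_1,\xi_2,\xi_3;x_1,x_2,x_3)$, $X^{\times2}=h^1(\xi_2\xi_3-(x_1|x_1),\ \xi_3\xi_1+(x_2|x_2),\ \xi_1\xi_2+(x_3|x_3);\ -\overline{x_2x_3}-\xi_1x_1,\ \overline{x_3x_1}-\xi_2x_2,\ \overline{x_1x_2}-\xi_3x_3)$. $E_1=h^1(1,0,0;0,0,0)$, $P^-=h^1(-1,1,0;0,0,1)$. Group: $\mathrm F_{4(-20)}=\{g\in \mathrm{GL}_{\mathbb R}(\mathcal J^1): g(X\circ Y)=gX\circ gY\}$, with Lie algebra $\mathfrak f_{4(-20)}$; $\exp$ is the exponential of linear maps. Operators in $\mathfrak f_{4(-20)}$: for $a\in\mathbf O$, on $X=h^1(\xi_1,\xi_2,\xi_3;x_1,x_2,x_3)$, $\tilde A_1^1(a)X=h^1(0,2(a|x_1),-2(a|x_1);-(\xi_2-\xi_3)a,-\overline{x_3a},\overline{ax_2})$, $\tilde A_2^1(a)X=h^1(2(a|x_2),0,-2(a|x_2);-\overline{ax_3},-(\xi_3-\xi_1)a,-\overline{x_1a})$, $\tilde A_3^1(a)X=h^1(-2(a|x_3),2(a|x_3),0;\overline{x_2a},\overline{ax_1},-(\xi_1-\xi_2)a)$; for $p\in\mathrm{Im}\,\mathbf O$, $\delta(p)X=h^1(0,0,0;px_1,x_2p,-(px_3+x_3p))$. Put $\mathcal G_1(x)=\tilde A_1^1(x)+\tilde A_2^1(-\overline x)$ and $\mathcal G_2(p)=\tilde A_3^1(-p)-\delta(p)$. Subgroups: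 $\sigma h^1(\xi_1,\xi_2,\xi_3;x_1,x_2,x_3)=h^1(\xi_1,\xi_2,\xi_3;x_1,-x_2,-x_3)$; $K=\{g\in\mathrm F_{4(-20)}:\sigma g\sigma=g\}$; $A=\{\exp(t\tilde A_3^1(1)):t\in\mathbb R\}$; $M=\{k\in K:k\tilde A_3^1(1)k^{-1}=\tilde A_3^1(1)\}$; $N^+=\{\exp(\mathcal G_1(x)+\mathcal G_2(p)):x\in\mathbf O,\ p\in\mathrm{Im}\,\mathbf O\}$. Null cone: $\mathcal N_1^-=\{X\in\mathcal J^1: X^{\times2}=0,\ \mathrm{tr}(X)=0,\ (E_1|X)<0\}$, which is an $\mathrm F_{4(-20)}$-orbit. For $X,Y\in\mathcal N_1^-$, $X\sim Y$ iff $Y=rX$ for some $r>0$; $[X]$ is the class of $X$, and $\mathcal F$ carries the quotient topology. $\simeq$ denotes an (equivariant) homeomorphism of homogeneous spaces induced by the orbit map. *)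

(* Defs.v *)
From HB Require Import structures.
From mathcomp Require Import all_boot all_order all_algebra.
From mathcomp Require Import all_classical all_reals all_analysis.
From mathcomp Require Import generic_quotient ring lra.

Set Implicit Arguments.
Unset Strict Implicit.
Unset Printing Implicit Defensive.

Import Order.TTheory GRing.Theory Num.Theory.
Import numFieldNormedType.Exports.

Local Open Scope classical_set_scope.
Local Open Scope ring_scope.
Local Open Scope quotient_scope.

(* Cayley-Dickson doubling: (a, b) stands for a + b e with e ^ 2 = -1. *)
Section CayleyDickson.
Variables (V : zmodType) (mul : V -> V -> V) (conj : V -> V).

Definition cd_mul (x y : V * V) : V * V :=
  (mul x.1 y.1 - mul (conj y.2) x.2, mul y.2 x.1 + mul x.2 (conj y.1)).

Definition cd_conj (x : V * V) : V * V := (conj x.1, - x.2).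

End CayleyDickson.

Section Octonions.
Variable R : realType.

(* The eight real coordinates of an octonion, read from left to right, are its
   coordinates in the standard basis e_0, ..., e_7.  The product is not the
   componentwise one that MathComp puts on pairs: [oct] carries no ring
   structure, and [omul] is used throughout. *)
Definition oct : Type := ((R * R) * (R * R)) * ((R * R) * (R * R)).
HB.instance Definition _ := NormedModule.on oct.

Definition omul : oct -> oct -> oct :=
  cd_mul (cd_mul (cd_mul *%R id) (cd_conj id)) (cd_conj (cd_conj id)).

Definition oconj : oct -> oct := cd_conj (cd_conj (cd_conj id)).

Definition oRe (x : oct) : R := x.1.1.1.

Definition oreal (r : R) : oct := ((r, 0), 0, 0).

Definition oone : oct := oreal 1.

Definition odot (x y : oct) : R := oRe (omul x (oconj y)).

Lemma odotE x y : odot x y =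
  x.1.1.1 * y.1.1.1 + x.1.1.2 * y.1.1.2 + x.1.2.1 * y.1.2.1 + x.1.2.2 * y.1.2.2 +
  (x.2.1.1 * y.2.1.1 + x.2.1.2 * y.2.1.2 + x.2.2.1 * y.2.2.1 + x.2.2.2 * y.2.2.2).
Proof. by rewrite /odot /oRe /=; ring. Qed.

(* The span of e_1, ..., e_7: the vectors whose e_0-coordinate vanishes. *)
Definition oIm : set oct := [set x | oRe x = 0].

Lemma oct_ext (x y : oct) :
  x.1.1.1 = y.1.1.1 -> x.1.1.2 = y.1.1.2 -> x.1.2.1 = y.1.2.1 ->
  x.1.2.2 = y.1.2.2 -> x.2.1.1 = y.2.1.1 -> x.2.1.2 = y.2.1.2 ->
  x.2.2.1 = y.2.2.1 -> x.2.2.2 = y.2.2.2 -> x = y.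
Proof.
by move: x y => [[[? ?] [? ?]] [[? ?] [? ?]]] [[[? ?] [? ?]] [[? ?] [? ?]]] /=
  -> -> -> -> -> -> -> ->.
Qed.

Lemma omul1x x : omul oone x = x.
Proof.
by case: x => [[[? ?] [? ?]] [[? ?] [? ?]]]; apply: oct_ext;
  rewrite /=; ring.
Qed.

Lemma omulx1 x : omul x oone = x.
Proof.
by case: x => [[[? ?] [? ?]] [[? ?] [? ?]]]; apply: oct_ext;
  rewrite /=; ring.
Qed.

Lemma odot_omul x y : odot (omul x y) (omul x y) = odot x x * odot y y.
Proof.
move: x y => [[[? ?] [? ?]] [[? ?] [? ?]]] [[[? ?] [? ?]] [[? ?] [? ?]]].
by rewrite /odot /oRe /=; ring.
Qed.

Lemma omul_oreall (r : R) (x : oct) : omul (oreal r) x = r *: x.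
Proof.
case: x => [[[? ?] [? ?]] [[? ?] [? ?]]]; apply: oct_ext;
  by rewrite /= /GRing.scale /=; ring.
Qed.

Lemma omul_orealr (r : R) (x : oct) : omul x (oreal r) = r *: x.
Proof.
case: x => [[[? ?] [? ?]] [[? ?] [? ?]]]; apply: oct_ext;
  by rewrite /= /GRing.scale /=; ring.
Qed.

Lemma omul0x (x : oct) : omul 0 x = 0.
Proof.
case: x => [[[? ?] [? ?]] [[? ?] [? ?]]]; apply: oct_ext;
  by rewrite /=; ring.
Qed.

Lemma omulx0 (x : oct) : omul x 0 = 0.
Proof.
case: x => [[[? ?] [? ?]] [[? ?] [? ?]]]; apply: oct_ext;
  by rewrite /=; ring.
Qed.

(* O tensor C: the pair (a, b) stands for a + sqrt(-1) b, with sqrt(-1) central. *)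
Definition octC : Type := oct * oct.
HB.instance Definition _ := NormedModule.on octC.

Definition ocmul (x y : octC) : octC :=
  (omul x.1 y.1 - omul x.2 y.2, omul x.1 y.2 + omul x.2 y.1).

Definition ocmulmx (A B : 'M[octC]_3) : 'M[octC]_3 :=
  \matrix_(i, j) \sum_(k < 3) ocmul (A i k) (B k j).

End Octonions.

Section ComplexOctonions.
Variable R : realType.
Local Notation oct := (oct R).

Definition cre (x : oct) : octC R := (x, 0).
Definition cim (x : oct) : octC R := (0, x).

Lemma cre1 x : (cre x).1 = x. Proof. by []. Qed.
Lemma cim2 x : (cim x).2 = x. Proof. by []. Qed.

Lemma crr x y : ocmul (cre x) (cre y) = cre (omul x y).
Proof. by rewrite /ocmul /cre /= !(omul0x, omulx0, oppr0, addr0, add0r). Qed.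
Lemma cri x y : ocmul (cre x) (cim y) = cim (omul x y).
Proof. by rewrite /ocmul /cre /cim /= !(omul0x, omulx0, oppr0, addr0, add0r). Qed.
Lemma cir x y : ocmul (cim x) (cre y) = cim (omul x y).
Proof. by rewrite /ocmul /cre /cim /= !(omul0x, omulx0, oppr0, addr0, add0r). Qed.
Lemma cii x y : ocmul (cim x) (cim y) = cre (- omul x y).
Proof. by rewrite /ocmul /cre /cim /= !(omul0x, omulx0, oppr0, addr0, add0r). Qed.
Lemma creD x y : cre x + cre y = cre (x + y).
Proof. by rewrite /cre -[LHS]/(x + y, 0 + 0) addr0. Qed.
Lemma cimD x y : cim x + cim y = cim (x + y).
Proof. by rewrite /cim -[LHS]/(0 + 0, x + y) addr0. Qed.
Lemma creZ r x : r *: cre x = cre (r *: x).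
Proof. by rewrite /cre -[LHS]/(r *: x, r *: 0) scaler0. Qed.
Lemma cimZ r x : r *: cim x = cim (r *: x).
Proof. by rewrite /cim -[LHS]/(r *: 0, r *: x) scaler0. Qed.
Lemma sum3 (V : zmodType) (F : 'I_3 -> V) : \sum_(k < 3) F k = F 0 + F 1 + F 2.
Proof.
rewrite !big_ord_recr big_ord0 /= add0r.
by congr (F _ + F _ + F _); apply: val_inj.
Qed.

Lemma ocmulmxE (A B : 'M[octC R]_3) i j : ocmulmx A B i j =
  ocmul (A i 0) (B 0 j) + ocmul (A i 1) (B 1 j) + ocmul (A i 2) (B 2 j).
Proof. by rewrite mxE sum3. Qed.

End ComplexOctonions.

Section JordanAlgebra.
Variable R : realType.
Local Notation oct := (oct R).

(* J^1 in the coordinates (xi_1, xi_2, xi_3, x_1, x_2, x_3); [h1mx] is the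
   matrix they stand for. *)
Definition J1 : Type := (R * R * R * oct * oct * oct)%type.
HB.instance Definition _ := NormedModule.on J1.

Definition h1 (a b c : R) (x y z : oct) : J1 := (a, b, c, x, y, z).

Definition h1mx (X : J1) : 'M[octC R]_3 :=
  let: (xi1, xi2, xi3, x1, x2, x3) := X in
  \matrix_(i < 3, j < 3)
    nth 0 (nth [::]
      [:: [:: cre (oreal xi1);  cim x3;          cim (oconj x2)];
          [:: cim (oconj x3);   cre (oreal xi2); cre x1];
          [:: cim x2;           cre (oconj x1);  cre (oreal xi3)]] i) j.

(* A left inverse of [h1mx]. *)
Definition mxh1 (A : 'M[octC R]_3) : J1 :=
  h1 (oRe (A 0 0).1) (oRe (A 1 1).1) (oRe (A 2 2).1)
     (A 1 2).1 (A 2 0).2 (A 0 1).2.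

Definition jordan_mx (A B : 'M[octC R]_3) : 'M[octC R]_3 :=
  \matrix_(i, j) (2^-1 *: (ocmulmx A B i j + ocmulmx B A i j)).

(* See [h1mx_jordan] below: the Jordan product of two elements of J^1 is again
   an element of J^1, so reading off its coordinates loses nothing. *)
Definition jordan (X Y : J1) : J1 := mxh1 (jordan_mx (h1mx X) (h1mx Y)).

Definition trJ (X : J1) : R :=
  let: (xi1, xi2, xi3, _, _, _) := X in xi1 + xi2 + xi3.

Definition formJ (X Y : J1) : R := trJ (jordan X Y).

Definition cross2 (X : J1) : J1 :=
  let: (xi1, xi2, xi3, x1, x2, x3) := X in
  h1 (xi2 * xi3 - odot x1 x1) (xi3 * xi1 + odot x2 x2) (xi1 * xi2 + odot x3 x3)
     (- oconj (omul x2 x3) - xi1 *: x1)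
     (oconj (omul x3 x1) - xi2 *: x2)
     (oconj (omul x1 x2) - xi3 *: x3).

Definition E1 : J1 := h1 1 0 0 0 0 0.
Definition Pminus : J1 := h1 (-1) 1 0 0 0 (oone R).

Definition sigmaJ (X : J1) : J1 :=
  let: (xi1, xi2, xi3, x1, x2, x3) := X in h1 xi1 xi2 xi3 x1 (- x2) (- x3).

Definition tA1 (a : oct) (X : J1) : J1 :=
  let: (xi1, xi2, xi3, x1, x2, x3) := X in
  h1 0 (2 * odot a x1) (- (2 * odot a x1))
     (- ((xi2 - xi3) *: a)) (- oconj (omul x3 a)) (oconj (omul a x2)).

Definition tA2 (a : oct) (X : J1) : J1 :=
  let: (xi1, xi2, xi3, x1, x2, x3) := X in
  h1 (2 * odot a x2) 0 (- (2 * odot a x2))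
     (- oconj (omul a x3)) (- ((xi3 - xi1) *: a)) (- oconj (omul x1 a)).

Definition tA3 (a : oct) (X : J1) : J1 :=
  let: (xi1, xi2, xi3, x1, x2, x3) := X in
  h1 (- (2 * odot a x3)) (2 * odot a x3) 0
     (oconj (omul x2 a)) (oconj (omul a x1)) (- ((xi1 - xi2) *: a)).

Definition deltaJ (p : oct) (X : J1) : J1 :=
  let: (xi1, xi2, xi3, x1, x2, x3) := X in
  h1 0 0 0 (omul p x1) (omul x2 p) (- (omul p x3 + omul x3 p)).

Definition G1 (x : oct) (X : J1) : J1 := tA1 x X + tA2 (- oconj x) X.
Definition G2 (p : oct) (X : J1) : J1 := tA3 (- p) X - deltaJ p X.

(* On a finite-dimensional space the exponential series of a linear map
   converges in operator norm, and its sum is computed pointwise. *)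
Definition expL (f : J1 -> J1) : J1 -> J1 :=
  fun X => limn (series (fun n => (n`!%:R)^-1 *: iter n f X)).

Definition F4 : set (J1 -> J1) :=
  [set g | [/\ linear g, bijective g
             & forall X Y, g (jordan X Y) = jordan (g X) (g Y)]].

Definition Ksub : set (J1 -> J1) :=
  [set g | F4 g /\ sigmaJ \o g \o sigmaJ = g].

Definition Asub : set (J1 -> J1) :=
  [set g | exists t : R, g = expL (fun X => t *: tA3 (oone R) X)].

Definition Msub : set (J1 -> J1) :=
  [set k | Ksub k /\ exists k', [/\ cancel k k', cancel k' k
                                  & k \o tA3 (oone R) \o k' = tA3 (oone R)]].

Definition Nplus : set (J1 -> J1) :=
  [set g | exists x p, oIm p /\ g = expL (fun X => G1 x X + G2 p X)].

Definition MANplus : set (J1 -> J1) :=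
  [set g | exists m a n, [/\ Msub m, Asub a, Nplus n & g = m \o a \o n]].

Definition nullcone : set J1 :=
  [set X | [/\ cross2 X = 0, trJ X = 0 & formJ E1 X < 0]].

End JordanAlgebra.

Arguments E1 {R}.
Arguments Pminus {R}.
Arguments F4 R : clear implicits.
Arguments Ksub R : clear implicits.
Arguments Asub R : clear implicits.
Arguments Msub R : clear implicits.
Arguments Nplus R : clear implicits.
Arguments MANplus R : clear implicits.
Arguments nullcone R : clear implicits.

Section JordanAlgebraTheory.
Variable R : realType.
Local Notation oct := (oct R).
Local Notation J1 := (J1 R).

Lemma h1mxK (X : J1) : mxh1 (h1mx X) = X.
Proof. by case: X => [[[[[? ?] ?] ?] ?] ?]; rewrite /mxh1 !mxE. Qed.

Lemma h1mxE (a b c : R) (x y z : oct) : let H := h1mx (h1 a b c x y z) in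
  (H 0 0 = cre (oreal a)) * (H 0 1 = cim z) * (H 0 2 = cim (oconj y)) *
  (H 1 0 = cim (oconj z)) * (H 1 1 = cre (oreal b)) * (H 1 2 = cre x) *
  (H 2 0 = cim y) * (H 2 1 = cre (oconj x)) * (H 2 2 = cre (oreal c)).
Proof. by move=> H; rewrite /H !mxE. Qed.

Lemma mx3P (A B : 'M[octC R]_3) :
  A 0 0 = B 0 0 -> A 0 1 = B 0 1 -> A 0 2 = B 0 2 ->
  A 1 0 = B 1 0 -> A 1 1 = B 1 1 -> A 1 2 = B 1 2 ->
  A 2 0 = B 2 0 -> A 2 1 = B 2 1 -> A 2 2 = B 2 2 -> A = B.
Proof.
move=> *; apply/matrixP => i j.
have h (k : 'I_3) : [\/ k = 0, k = 1 | k = 2].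
  case: k => [[|[|[|//]]] hk]; [constructor 1|constructor 2|constructor 3]; exact: val_inj.
by case: (h i) => ->; case: (h j) => ->.
Qed.

Lemma jordan_mxE (A B : 'M[octC R]_3) i j : jordan_mx A B i j = 2^-1 *:
  (ocmul (A i 0) (B 0 j) + ocmul (A i 1) (B 1 j) + ocmul (A i 2) (B 2 j)
   + (ocmul (B i 0) (A 0 j) + ocmul (B i 1) (A 1 j) + ocmul (B i 2) (A 2 j))).
Proof. by rewrite mxE !ocmulmxE. Qed.

Lemma h1mx_jordan (X Y : J1) : h1mx (jordan X Y) = jordan_mx (h1mx X) (h1mx Y).
Proof.
Opaque cre cim omul oconj oreal ocmul h1mx.
move: X Y => [[[[[a1 a2] a3] x1] x2] x3] [[[[[b1 b2] b3] y1] y2] y3].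
rewrite -[(a1, _, _, _, _, _)]/(h1 _ _ _ _ _ _) -[(b1, _, _, _, _, _)]/(h1 _ _ _ _ _ _).
have e1 := h1mxE a1 a2 a3 x1 x2 x3; have e2 := h1mxE b1 b2 b3 y1 y2 y3.
rewrite /jordan /mxh1; move: (h1mx _) (h1mx _) e1 e2 => H1 H2 e1 e2.
apply: mx3P; rewrite h1mxE !jordan_mxE !e1 !e2;
  rewrite !(crr, cii, cri, cir, creD, cimD, creZ, cimZ) ?(cre1, cim2); congr (_ _);
  rewrite !(omul_oreall, omul_orealr).
Transparent cre cim omul oconj oreal ocmul h1mx.
all: clear H1 e1 H2 e2.
all: move: x1 x2 x3 y1 y2 y3 =>
  [[[x12 x13] [x14 x15]] [[x16 x17] [x18 x19]]]
  [[[x20 x21] [x22 x23]] [[x24 x25] [x26 x27]]]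
  [[[x4 x5] [x6 x7]] [[x8 x9] [x10 x11]]]
  [[[y12 y13] [y14 y15]] [[y16 y17] [y18 y19]]]
  [[[y20 y21] [y22 y23]] [[y24 y25] [y26 y27]]]
  [[[y4 y5] [y6 y7]] [[y8 y9] [y10 y11]]].
all: apply: oct_ext; rewrite /= /GRing.scale /= /oRe /= /GRing.scale /=; ring.
Qed.

Lemma formJE (a1 a2 a3 b1 b2 b3 : R) (x1 x2 x3 y1 y2 y3 : oct) :
  formJ (h1 a1 a2 a3 x1 x2 x3) (h1 b1 b2 b3 y1 y2 y3) =
  a1 * b1 + a2 * b2 + a3 * b3
  + 2 * odot x1 y1 - 2 * odot x2 y2 - 2 * odot x3 y3.
Proof.
Opaque cre cim omul oconj oreal ocmul h1mx.
have e1 := h1mxE a1 a2 a3 x1 x2 x3; have e2 := h1mxE b1 b2 b3 y1 y2 y3.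
rewrite /formJ /jordan; move: (h1mx _) (h1mx _) e1 e2 => H1 H2 e1 e2.
rewrite /mxh1 /trJ /h1 !jordan_mxE !e1 !e2.
rewrite !(crr, cii, cri, cir, creD, cimD, creZ, cimZ) ?(cre1, cim2).
rewrite !(omul_oreall, omul_orealr) !odotE.
Transparent cre cim omul oconj oreal ocmul h1mx.
clear H1 e1 H2 e2.
move: x1 x2 x3 y1 y2 y3 =>
  [[[x12 x13] [x14 x15]] [[x16 x17] [x18 x19]]]
  [[[x20 x21] [x22 x23]] [[x24 x25] [x26 x27]]]
  [[[x4 x5] [x6 x7]] [[x8 x9] [x10 x11]]]
  [[[y12 y13] [y14 y15]] [[y16 y17] [y18 y19]]]
  [[[y20 y21] [y22 y23]] [[y24 y25] [y26 y27]]]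
  [[[y4 y5] [y6 y7]] [[y8 y9] [y10 y11]]].
by rewrite /= /GRing.scale /= /oRe /= /GRing.scale /=; field.
Qed.

Lemma nullcone_Pminus : nullcone R Pminus.
Proof.
split; [|by rewrite /=; lra|by rewrite /E1 /Pminus formJE !odotE /=; lra].
rewrite /cross2 /Pminus /h1 !odotE /=; congr (_, _, _, _, _, _).
all: try (apply: oct_ext; rewrite /= /GRing.scale /=).
all: by ring.
Qed.

Lemma F4_id : F4 R id.
Proof. by split => //; exists id. Qed.

Lemma F4_comp g h : F4 R g -> F4 R h -> F4 R (g \o h).
Proof.
move=> [lg bg jg] [lh bh jh]; split.
- by move=> a X Y /=; rewrite lh lg.
- exact: bij_comp.
- by move=> X Y /=; rewrite jh jg.
Qed.

Lemma F4_inv g g' : F4 R g -> cancel g g' -> cancel g' g -> F4 R g'.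
Proof.
move=> [lg bg jg] gK g'K; split.
- by move=> a X Y; apply: (can_inj gK); rewrite lg !g'K.
- by exists g.
- by move=> X Y; apply: (can_inj gK); rewrite jg !g'K.
Qed.

Lemma sigmaJK : involutive (@sigmaJ R).
Proof. by case=> [[[[[? ?] ?] ?] ?] ?]; rewrite /sigmaJ /h1 !opprK. Qed.

Lemma Ksub_comp g h : Ksub R g -> Ksub R h -> Ksub R (g \o h).
Proof.
move=> [Fg sg] [Fh sh]; split; first exact: F4_comp.
rewrite -[in RHS]sg -[in RHS]sh; apply/funext => X /=.
by rewrite sigmaJK.
Qed.

End JordanAlgebraTheory.

(* The space of left cosets gH, for a set G of self-maps of V and a subset H.
   G carries the topology of pointwise convergence, which on linear self-maps of
   a finite-dimensional space is the norm topology (that of the matrix entries),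
   and the coset space the quotient topology. *)
Section CosetSpace.
Variables (V : topologicalType) (G H : set {ptws V -> V}).

Definition coset_rel (g h : G) : bool :=
  `[< [set val g \o x | x in H] = [set val h \o x | x in H] >].

Lemma coset_rel_refl : reflexive coset_rel.
Proof. by move=> g; apply/asboolP. Qed.

Lemma coset_rel_sym : symmetric coset_rel.
Proof. by move=> g h; apply/asboolP/asboolP => ->. Qed.

Lemma coset_rel_trans : transitive coset_rel.
Proof. by move=> g h k /asboolP gh /asboolP hk; apply/asboolP; rewrite gh. Qed.

Canonical coset_equiv_rel :=
  EquivRel coset_rel coset_rel_refl coset_rel_sym coset_rel_trans.

Definition coset_space : Type := quotient_topology {eq_quot coset_equiv_rel}.
HB.instance Definition _ := Topological.on coset_space.

Definition lcoset (g : G) : coset_space := (\pi_coset_space g)%qT.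

End CosetSpace.

Definition homeomorphism (S T : topologicalType) (f : S -> T) :=
  exists f' : T -> S,
    [/\ continuous f, continuous f', cancel f f' & cancel f' f].

Section ProjectivizedCone.
Variable R : realType.
Local Notation J1 := (J1 R).

Definition ray_rel (X Y : nullcone R) : bool :=
  `[< exists2 r : R, 0 < r & val Y = r *: val X >].

Lemma ray_rel_refl : reflexive ray_rel.
Proof. by move=> X; apply/asboolP; exists 1; [exact: ltr01|rewrite scale1r]. Qed.

Lemma ray_rel_sym : symmetric ray_rel.
Proof.
suff h X Y : ray_rel X Y -> ray_rel Y X by move=> X Y; apply/idP/idP; exact: h.
move=> /asboolP[r r0 XY]; apply/asboolP; exists r^-1; first by rewrite invr_gt0.
by rewrite XY scalerA mulVf ?gt_eqF ?scale1r.
Qed.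

Lemma ray_rel_trans : transitive ray_rel.
Proof.
move=> Y X Z /asboolP[r r0 XY] /asboolP[s s0 YZ]; apply/asboolP.
exists (s * r); first exact: mulr_gt0.
by rewrite YZ {YZ}XY {XY}scalerA.
Qed.

Canonical ray_equiv_rel :=
  EquivRel ray_rel ray_rel_refl ray_rel_sym ray_rel_trans.

Definition Fspace : Type := quotient_topology {eq_quot ray_equiv_rel}.
HB.instance Definition _ := Topological.on Fspace.

(* [ray X] is the class of X when X lies in the null cone; elsewhere it has the
   irrelevant value [ray Pminus]. *)
Definition ray (X : J1) : Fspace :=
  (\pi_Fspace (insubd (exist _ Pminus (mem_set (nullcone_Pminus R))) X
                 : nullcone R))%qT.

(* g[X] = [gX], computed on a representative. *)
Definition act (g : J1 -> J1) (c : Fspace) : Fspace :=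
  ray (g (val (repr c : nullcone R))).

(* The orbit map g |-> g[P^-] of G induces an equivariant homeomorphism of G / H
   onto the space of rays. *)
Definition orbit_homeo (G H : set {ptws J1 -> J1}) (phi : coset_space G H -> Fspace) :=
  [/\ homeomorphism phi,
      forall g : G, phi (lcoset H g) = act (val g) (ray Pminus)
    & forall g h gh : G, val gh = val g \o val h ->
        phi (lcoset H gh) = act (val g) (phi (lcoset H h))].

End ProjectivizedCone.

(* Main.v *)
(* An element of J^1 lies in the null cone iff its square vanishes and its first diagonal entry is
   negative.  Up to scaling it is determined by a point (x2, x3) of the sphere S^15, on which the
   subgroup of K generated by the rotations exp (tA1 a) is transitive; explicit products of these
   rotations give local continuous sections of the orbit maps, so that the orbit maps are open.

   An automorphism maps P^- to a multiple of an element of the null cone, and the sign of that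
   multiple is positive because the quadratic form X |-> (P^-|X o X) has signature (9, 1) modulo
   its radical, hence is not equivalent to its opposite.

   If g P^- = r P^-, let Q = sigma P^-.  After correcting g by an element of A we have r = 1, and
   N^+ is transitive on the null vectors Y with (P^-|Y) = (P^-|Q), so a further correction by an
   element of N^+ fixes Q as well.  An automorphism fixing P^- and Q fixes E_1 and
   F = h^1(0, 0, 0; 0, 0, 1), hence commutes with sigma = 1 + 8 (L^2 - L), where L = L(E_1) is the
   multiplication by E_1, and with tA3 1 = 4 [L(E_1), L(F)]: it belongs to M. *)

From HB Require Import structures.
Require Import Defs.
From mathcomp Require Import all_boot all_order all_algebra.
From mathcomp Require Import all_classical all_reals all_analysis.
From mathcomp Require Import generic_quotient ring lra.

Set Implicit Arguments.
Unset Strict Implicit.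
Unset Printing Implicit Defensive.

Import Order.TTheory GRing.Theory Num.Theory.
Import numFieldNormedType.Exports.

Local Open Scope classical_set_scope.
Local Open Scope ring_scope.

(** * Octonions *)

(** [F4] is defined by the Jordan product alone, so the invariance of the trace, of (X|Y) and of the
    sign of a diagonal entry is not given. Each invariant in use is extracted from multiplication
    operators: P^- o (P^- o X) is (P^-|X)/2 times P^-, and 2 L(E_1)^2 - L(E_1) sends X to (E_1|X)
    E_1. The sign could be settled by connectedness of the group; comparing signatures avoids
    establishing it. The exponentials need no general Lie theory: tA3 1 is diagonalizable and the
    elements of the Lie algebra of N^+ are nilpotent, so multiplicativity of the exponential of a
    derivation reduces to finite sums. P^- and Q are eigenvectors of tA3 1 for the extreme
    eigenvalues 2 and -2. Hence A scales them by inverse factors while N^+ fixes P^-, and the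
    corrections by A and N^+ do not undo each other. *)

Ltac oct_coord :=
  repeat match goal with |- forall _, _ => let x := fresh "x" in intro x end;
  repeat match goal with x : oct _ |- _ => destruct x as [[[? ?] [? ?]] [[? ?] [? ?]]] end;
  rewrite ?odotE.
(** The octonion operations are made opaque further on; they are reopened here, when an identity is
    handed to [ring] or [field] in real coordinates. *)
Ltac oct_simpl := with_strategy transparent [omul oconj odot add_pair pair_opp scale_pair]
  (rewrite /= /GRing.scale /=).
Ltac oct_ring := oct_coord; apply: oct_ext; oct_simpl; ring.
Ltac oct_field := oct_coord; apply: oct_ext; oct_simpl; field.
Ltac dot_ring := oct_coord; oct_simpl; ring.

Section OctonionIdentities.
Variable R : realType.
Local Notation oct := (oct R).
Implicit Types (r s : R) (x y z b : oct).

Lemma oconjN x : oconj (- x) = - oconj x. Proof. by oct_ring. Qed.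
Lemma omulNr x y : omul x (- y) = - omul x y. Proof. by oct_ring. Qed.
Lemma odotC x y : odot x y = odot y x. Proof. by dot_ring. Qed.
Lemma odotNl x y : odot (- x) y = - odot x y. Proof. by dot_ring. Qed.
Lemma odotNr x y : odot x (- y) = - odot x y. Proof. by dot_ring. Qed.
Lemma odotZl r x y : odot (r *: x) y = r * odot x y. Proof. by dot_ring. Qed.
Lemma odotZr r x y : odot x (r *: y) = r * odot x y. Proof. by dot_ring. Qed.
Lemma odot_conj x y : odot (oconj x) (oconj y) = odot x y. Proof. by dot_ring. Qed.

(** Cyclic invariance of the trilinear form Re(xyz), which survives the failure of associativity. *)
Lemma odot_cyc x y z : odot x (oconj (omul y z)) = odot y (oconj (omul z x)).
Proof. by dot_ring. Qed.

Lemma odot_ge0 x : 0 <= odot x x.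
Proof. by rewrite odotE; do !apply: addr_ge0; rewrite -expr2 sqr_ge0. Qed.

Lemma odot_eq0 x : odot x x = 0 -> x = 0.
Proof.
rewrite odotE => /eqP.
rewrite -!expr2 !paddr_eq0 ?addr_ge0 ?sqr_ge0 // !sqrf_eq0.
case/andP => /andP[/andP[/andP[/eqP? /eqP?] /eqP?] /eqP?].
case/andP => /andP[/andP[/eqP? /eqP?] /eqP?] /eqP?.
exact: oct_ext.
Qed.

Lemma odot_gt0 x : x != 0 -> 0 < odot x x.
Proof.
move=> x0; rewrite lt_neqAle odot_ge0 andbT eq_sym.
by apply: contra_neq x0; exact: odot_eq0.
Qed.
End OctonionIdentities.

Section Jordan.
Variable R : realType.
Local Notation oct := (oct R).
Local Notation J1 := (J1 R).

Lemma J1_ext (a1 a2 a3 b1 b2 b3 : R) (x1 x2 x3 y1 y2 y3 : oct) :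
  a1 = b1 -> a2 = b2 -> a3 = b3 -> x1 = y1 -> x2 = y2 -> x3 = y3 ->
  h1 a1 a2 a3 x1 x2 x3 = h1 b1 b2 b3 y1 y2 y3.
Proof. by move=> -> -> -> -> -> ->. Qed.

Lemma J1P (X : J1) : exists a1 a2 a3 x1 x2 x3, X = h1 a1 a2 a3 x1 x2 x3.
Proof.
by case: X => [[[[[a1 a2] a3] x1] x2] x3]; exists a1, a2, a3, x1, x2, x3.
Qed.

Lemma jordanE (a1 a2 a3 b1 b2 b3 : R) (x1 x2 x3 y1 y2 y3 : oct) :
  jordan (h1 a1 a2 a3 x1 x2 x3) (h1 b1 b2 b3 y1 y2 y3) =
  h1 (a1 * b1 - odot x2 y2 - odot x3 y3) (a2 * b2 + odot x1 y1 - odot x3 y3)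
     (a3 * b3 + odot x1 y1 - odot x2 y2)
     (2^-1 *: ((a2 + a3) *: y1 + (b2 + b3) *: x1
               - oconj (omul x2 y3) - oconj (omul y2 x3)))
     (2^-1 *: ((a3 + a1) *: y2 + (b3 + b1) *: x2
               + oconj (omul x3 y1) + oconj (omul y3 x1)))
     (2^-1 *: ((a1 + a2) *: y3 + (b1 + b2) *: x3
               + oconj (omul x1 y2) + oconj (omul y1 x2))).
Proof.
Opaque cre cim omul oconj oreal ocmul h1mx.
have e1 := h1mxE a1 a2 a3 x1 x2 x3; have e2 := h1mxE b1 b2 b3 y1 y2 y3.
rewrite /jordan /mxh1; move: (h1mx _) (h1mx _) e1 e2 => H1 H2 e1 e2.
rewrite !jordan_mxE !e1 !e2.
rewrite !(crr, cii, cri, cir, creD, cimD, creZ, cimZ) ?(cre1, cim2).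
rewrite !(omul_oreall, omul_orealr) !odotE.
Transparent cre cim omul oconj oreal ocmul h1mx.
clear H1 e1 H2 e2.
move: x1 x2 x3 y1 y2 y3 =>
  [[[x12 x13] [x14 x15]] [[x16 x17] [x18 x19]]]
  [[[x20 x21] [x22 x23]] [[x24 x25] [x26 x27]]]
  [[[x4 x5] [x6 x7]] [[x8 x9] [x10 x11]]]
  [[[y12 y13] [y14 y15]] [[y16 y17] [y18 y19]]]
  [[[y20 y21] [y22 y23]] [[y24 y25] [y26 y27]]]
  [[[y4 y5] [y6 y7]] [[y8 y9] [y10 y11]]].
apply: J1_ext.
all: try (apply: oct_ext).
all: rewrite /= /GRing.scale /= /oRe /= /GRing.scale /=; by field.
Qed.

Lemma h1D (a1 a2 a3 b1 b2 b3 : R) (x1 x2 x3 y1 y2 y3 : oct) :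
  h1 a1 a2 a3 x1 x2 x3 + h1 b1 b2 b3 y1 y2 y3 =
  h1 (a1 + b1) (a2 + b2) (a3 + b3) (x1 + y1) (x2 + y2) (x3 + y3).
Proof. by []. Qed.

Lemma h1Z (r a1 a2 a3 : R) (x1 x2 x3 : oct) : r *: h1 a1 a2 a3 x1 x2 x3 =
  h1 (r * a1) (r * a2) (r * a3) (r *: x1) (r *: x2) (r *: x3).
Proof. by []. Qed.

Lemma h1N (a1 a2 a3 : R) (x1 x2 x3 : oct) : - h1 a1 a2 a3 x1 x2 x3 =
  h1 (- a1) (- a2) (- a3) (- x1) (- x2) (- x3).
Proof. by []. Qed.

Lemma h10 : 0 = h1 0 0 0 0 0 0 :> J1.
Proof. by []. Qed.
End Jordan.

(** * Automorphisms of the Jordan algebra *)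

#[local] Opaque jordan formJ.

Section LinearMaps.
Variables (R : realType) (V W : lmodType R).
Implicit Types (g : V -> W).

Lemma linear_addE g : linear g -> {morph g : x y / x + y}.
Proof. by move=> lg x y; rewrite -[x]scale1r lg !scale1r. Qed.
Lemma linear_0E g : linear g -> g 0 = 0.
Proof. by move=> lg; apply: (addrI (g 0)); rewrite -linear_addE // !addr0. Qed.
Lemma linear_scaleE g : linear g -> forall r, {morph g : x / r *: x}.
Proof.
by move=> lg r x; rewrite -[r *: x]addr0 lg linear_0E // addr0.
Qed.
Lemma linear_oppE g : linear g -> {morph g : x / - x}.
Proof. by move=> lg x; rewrite -scaleN1r linear_scaleE // scaleN1r. Qed.

End LinearMaps.

(** Polarization: expanding the square of x + y leaves twice the mixed product. Only squares then
    need a coordinate computation. *)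
Lemma morph_of_sq (R : realType) (V : lmodType R) (m : V -> V -> V) (g : V -> V) :
  commutative m -> left_distributive m +%R -> linear g ->
  (forall x, g (m x x) = m (g x) (g x)) -> forall x y, g (m x y) = m (g x) (g y).
Proof.
move=> mC mDl lg sq x y; have gD := linear_addE lg.
have mDr z : {morph m z : x y / x + y} by move=> u v; rewrite mC mDl ![m _ z]mC.
have := sq (x + y); rewrite gD !(mDl, mDr) !gD !sq.
rewrite -!addrA => /addrI; rewrite !addrA => /addIr.
rewrite [m y x]mC [m (g y) _]mC -(mulr2n (g (m x y))) -(mulr2n (m (g x) (g y))) => h.
by move: h; rewrite -[LHS]scaler_nat -[RHS]scaler_nat => h; apply: scalerI h; rewrite pnatr_eq0.
Qed.

Section Automorphisms.
Variable R : realType.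
Local Notation oct := (oct R).
Local Notation J1 := (J1 R).

Lemma jordanC (X Y : J1) : jordan X Y = jordan Y X.
Proof.
have [a1 [a2 [a3 [x1 [x2 [x3 ->]]]]]] := J1P X.
have [b1 [b2 [b3 [y1 [y2 [y3 ->]]]]]] := J1P Y.
rewrite !jordanE; apply: J1_ext;
  rewrite ?(odotC y1) ?(odotC y2) ?(odotC y3); try ring.
all: congr (_ *: _); rewrite [_ *: y1 + _]addrC ?[_ *: y2 + _]addrC ?[_ *: y3 + _]addrC.
all: by rewrite addrAC.
Qed.

Lemma jordanDl (X Y Z : J1) : jordan (X + Y) Z = jordan X Z + jordan Y Z.
Proof.
have [a1 [a2 [a3 [x1 [x2 [x3 ->]]]]]] := J1P X.
have [b1 [b2 [b3 [y1 [y2 [y3 ->]]]]]] := J1P Y.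
have [c1 [c2 [c3 [z1 [z2 [z3 ->]]]]]] := J1P Z.
rewrite h1D !jordanE h1D; apply: J1_ext.
all: move: x1 x2 x3 y1 y2 y3 z1 z2 z3; clear.
1-3: by dot_ring.
all: by oct_ring.
Qed.

Lemma jordanZl r (X Y : J1) : jordan (r *: X) Y = r *: jordan X Y.
Proof.
have [a1 [a2 [a3 [x1 [x2 [x3 ->]]]]]] := J1P X.
have [b1 [b2 [b3 [y1 [y2 [y3 ->]]]]]] := J1P Y.
rewrite h1Z !jordanE h1Z; apply: J1_ext.
all: move: x1 x2 x3 y1 y2 y3; clear.
1-3: by dot_ring.
all: by oct_ring.
Qed.

Lemma jordanZr r (X Y : J1) : jordan X (r *: Y) = r *: jordan X Y.
Proof. by rewrite ![jordan X _]jordanC jordanZl. Qed.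
Lemma jordanNl (X Y : J1) : jordan (- X) Y = - jordan X Y.
Proof. by rewrite -scaleN1r jordanZl scaleN1r. Qed.
Lemma jordanNr (X Y : J1) : jordan X (- Y) = - jordan X Y.
Proof. by rewrite -scaleN1r jordanZr scaleN1r. Qed.

Lemma jordan_sqE (a1 a2 a3 : R) (x1 x2 x3 : oct) :
  jordan (h1 a1 a2 a3 x1 x2 x3) (h1 a1 a2 a3 x1 x2 x3) =
  h1 (a1 ^+ 2 - odot x2 x2 - odot x3 x3) (a2 ^+ 2 + odot x1 x1 - odot x3 x3)
     (a3 ^+ 2 + odot x1 x1 - odot x2 x2)
     ((a2 + a3) *: x1 - oconj (omul x2 x3))
     ((a3 + a1) *: x2 + oconj (omul x3 x1))
     ((a1 + a2) *: x3 + oconj (omul x1 x2)).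
Proof.
rewrite jordanE; apply: J1_ext => //; move: (oconj _) => y.
all: by move: x1 x2 x3 y; oct_field.
Qed.

Lemma F4_of_sq (g : J1 -> J1) : linear g -> bijective g ->
  (forall X, g (jordan X X) = jordan (g X) (g X)) -> F4 R g.
Proof.
move=> lg bg sq; split=> [||X Y]; [exact: lg|exact: bg|].
exact: (morph_of_sq jordanC jordanDl lg sq).
Qed.

Lemma F4Z (g : J1 -> J1) r X : F4 R g -> g (r *: X) = r *: g X.
Proof. by case=> lg _ _; exact: linear_scaleE. Qed.
Lemma F4_0 (g : J1 -> J1) : F4 R g -> g 0 = 0.
Proof. by case=> lg _ _; exact: linear_0E. Qed.
End Automorphisms.

(** * The rotations in K *)

(* Keeps unification from unfolding the coordinates. *)
#[local] Opaque omul odot oconj add_pair pair_opp scale_pair.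

Section Rotations.
Variable R : realType.
Local Notation oct := (oct R).
Local Notation J1 := (J1 R).

Lemma sigmaJE (a1 a2 a3 : R) (x1 x2 x3 : oct) :
  sigmaJ (h1 a1 a2 a3 x1 x2 x3) = h1 a1 a2 a3 x1 (- x2) (- x3).
Proof. by []. Qed.

(* With c = cos t and b = (sin t) a, |a| = 1, this is exp (t tA1 a). *)
Definition kmap (c : R) (b : oct) (X : J1) : J1 :=
  let: (a1, a2, a3, x1, x2, x3) := X in
  h1 a1 (c ^+ 2 * a2 + odot b b * a3 + 2 * c * odot b x1)
        (odot b b * a2 + c ^+ 2 * a3 - 2 * c * odot b x1)
     (x1 - (2 * odot b x1 + c * (a2 - a3)) *: b)
     (c *: x2 - oconj (omul x3 b)) (c *: x3 + oconj (omul b x2)).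

Lemma kmapE (c : R) (b : oct) (a1 a2 a3 : R) (x1 x2 x3 : oct) :
  kmap c b (h1 a1 a2 a3 x1 x2 x3) =
  h1 a1 (c ^+ 2 * a2 + odot b b * a3 + 2 * c * odot b x1)
        (odot b b * a2 + c ^+ 2 * a3 - 2 * c * odot b x1)
     (x1 - (2 * odot b x1 + c * (a2 - a3)) *: b)
     (c *: x2 - oconj (omul x3 b)) (c *: x3 + oconj (omul b x2)).
Proof. by []. Qed.

Section Unit.
Variables (c : R) (b : oct).
Hypothesis cb : c ^+ 2 + odot b b = 1.

Let N1 : odot b b = 1 - c ^+ 2. Proof. by move: cb; lra. Qed.

Lemma kmap_linear : linear (kmap c b).
Proof.
move=> r X Y.
have [a1 [a2 [a3 [x1 [x2 [x3 ->]]]]]] := J1P X.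
have [b1 [b2 [b3 [y1 [y2 [y3 ->]]]]]] := J1P Y.
rewrite h1Z h1D !kmapE h1Z h1D; apply: J1_ext;
  generalize b x1 x2 x3 y1 y2 y3; clear.
1-3: by dot_ring.
all: by oct_ring.
Qed.

(** Expanding everything into real coordinates at once would be too large. Every norm and product of
    rotated entries is first reduced to a few scalars and octonion monomials; [T], the value of
    Re(b(x2 x3)), is the only trilinear scalar. What remains is polynomial in these atoms, modulo
    c^2 + |b|^2 = 1. *)
Lemma kmap_sq X : kmap c b (jordan X X) = jordan (kmap c b X) (kmap c b X).
Proof.
have [a1 [a2 [a3 [x1 [x2 [x3 ->]]]]]] := J1P X.
rewrite kmapE !jordan_sqE kmapE.
set T := odot b (oconj (omul x2 x3)).
have n2 : odot (c *: x2 - oconj (omul x3 b)) (c *: x2 - oconj (omul x3 b)) =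
    c ^+ 2 * odot x2 x2 + odot b b * odot x3 x3 - 2 * c * T.
  by rewrite /T; generalize b x2 x3; clear; dot_ring.
have n3 : odot (c *: x3 + oconj (omul b x2)) (c *: x3 + oconj (omul b x2)) =
    c ^+ 2 * odot x3 x3 + odot b b * odot x2 x2 + 2 * c * T.
  by rewrite /T; generalize b x2 x3; clear; dot_ring.
have n1 e : odot (x1 - e *: b) (x1 - e *: b) =
    odot x1 x1 + e ^+ 2 * odot b b - 2 * e * odot b x1.
  by generalize b x1; clear; dot_ring.
have nX s : odot b (s *: x1 - oconj (omul x2 x3)) = s * odot b x1 - T.
  by rewrite /T; generalize (oconj (omul x2 x3)) b x1; clear; dot_ring.
have m1 : oconj (omul (c *: x2 - oconj (omul x3 b)) (c *: x3 + oconj (omul b x2))) =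
    (c ^+ 2 + odot b b) *: oconj (omul x2 x3)
    + (c * (odot x2 x2 - odot x3 x3) - 2 * T) *: b.
  by rewrite /T; generalize b x2 x3; clear; oct_ring.
have m2 e : oconj (omul (c *: x3 + oconj (omul b x2)) (x1 - e *: b)) =
    c *: oconj (omul x3 x1) - (c * e) *: oconj (omul x3 b)
    + (2 * odot b x1 - e * odot b b) *: x2 - oconj (omul (oconj (omul x1 x2)) b).
  by generalize b x1 x2 x3; clear; oct_ring.
have m2' s y : oconj (omul (s *: x3 + y) b) = s *: oconj (omul x3 b) + oconj (omul y b).
  by generalize b x3 y; clear; oct_ring.
have m3 e : oconj (omul (x1 - e *: b) (c *: x2 - oconj (omul x3 b))) =
    c *: oconj (omul x1 x2) - (c * e) *: oconj (omul b x2)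
    - (2 * odot b x1 - e * odot b b) *: x3 + oconj (omul b (oconj (omul x3 x1))).
  by generalize b x1 x2 x3; clear; oct_ring.
have m3' s y : oconj (omul b (s *: x2 + y)) = s *: oconj (omul b x2) + oconj (omul b y).
  by generalize b x2 y; clear; oct_ring.
pose e := 2 * odot b x1 + c * (a2 - a3).
rewrite n2 n3 n1 nX m1 (m2 e) (m2' (a1 + a2)) (m3 e) (m3' (a3 + a1)) {}/e cb scale1r N1.
move: T {n2 n3 n1 nX m1 m2 m2' m3 m3'} => T.
move: (odot b x1) (odot x1 x1) (odot x2 x2) (odot x3 x3) => be q1 q2 q3.
apply: J1_ext.
1-3: ring.
- by move: (oconj _) => y; generalize b x1 y; clear; oct_ring.
- move: (oconj (omul x3 x1)) (oconj (omul x3 b)) (oconj _) => y z t.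
  by generalize b x2 y z t; clear; oct_ring.
- move: (oconj (omul x1 x2)) (oconj (omul b x2)) (oconj _) => y z t.
  by generalize b x3 y z t; clear; oct_ring.
Qed.

End Unit.

Lemma kmapK c b : c ^+ 2 + odot b b = 1 -> cancel (kmap c b) (kmap c (- b)).
Proof.
move=> cb X; have N1 : odot b b = 1 - c ^+ 2 by move: cb; lra.
have [a1 [a2 [a3 [x1 [x2 [x3 ->]]]]]] := J1P X.
rewrite !kmapE.
have e1 e : odot (- b) (x1 - e *: b) = e * odot b b - odot b x1.
  by generalize b x1; clear; dot_ring.
have e0 : odot (- b) (- b) = odot b b by generalize b; clear; dot_ring.
have e2 : oconj (omul (c *: x3 + oconj (omul b x2)) (- b)) =
    - c *: oconj (omul x3 b) - odot b b *: x2.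
  by generalize b x2 x3; clear; oct_ring.
have e3 : oconj (omul (- b) (c *: x2 - oconj (omul x3 b))) =
    - c *: oconj (omul b x2) + odot b b *: x3.
  by generalize b x2 x3; clear; oct_ring.
rewrite e1 e0 e2 e3 N1; move: (odot b x1) {e1 e0 e2 e3 N1 cb} => be.
apply: J1_ext.
1-3: ring.
- by generalize b x1; clear; oct_ring.
- by move: (oconj (omul x3 b)) x2; oct_ring.
- by move: (oconj (omul b x2)) x3; oct_ring.
Qed.

Lemma kmap_K c b : c ^+ 2 + odot b b = 1 -> Ksub R (kmap c b).
Proof.
move=> cb.
have cNb : c ^+ 2 + odot (- b) (- b) = 1 by rewrite odotNl odotNr opprK.
split.
  apply: F4_of_sq; [exact: kmap_linear| |exact: kmap_sq].
  exists (kmap c (- b)); first exact: kmapK.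
  by have := kmapK cNb; rewrite opprK.
apply/funext => X; have [a1 [a2 [a3 [x1 [x2 [x3 ->]]]]]] := J1P X.
rewrite -[LHS]/(sigmaJ (kmap c b (sigmaJ _))) sigmaJE !kmapE sigmaJE.
apply: J1_ext => //.
- by generalize b x2 x3; clear; oct_ring.
- by generalize b x2 x3; clear; oct_ring.
Qed.
End Rotations.

(** * The null cone *)

Section NullCone.
Variable R : realType.
Local Notation oct := (oct R).
Local Notation J1 := (J1 R).

Lemma h1_inj (a1 a2 a3 b1 b2 b3 : R) (x1 x2 x3 y1 y2 y3 : oct) :
  h1 a1 a2 a3 x1 x2 x3 = h1 b1 b2 b3 y1 y2 y3 ->
  [/\ a1 = b1, a2 = b2 & a3 = b3] /\ [/\ x1 = y1, x2 = y2 & x3 = y3].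
Proof. by case=> -> -> -> -> -> ->. Qed.

Lemma odot_norm_omul (x y : oct) :
  odot (oconj (omul x y)) (oconj (omul x y)) = odot x x * odot y y.
Proof. by rewrite odot_conj odot_omul. Qed.

(** The off-diagonal equations express each conj(x_j x_k) as a multiple of x_i. Multiplicativity of
    the norm and cyclicity of Re(xyz) then eliminate the octonions, leaving real equations in the
    a_i and in p, q, r, the squared norms of x1, x2, x3. *)
Lemma jordan_sq0_tr (X : J1) : jordan X X = 0 -> trJ X = 0.
Proof.
have [a1 [a2 [a3 [x1 [x2 [x3 ->]]]]]] := J1P X.
rewrite jordan_sqE h10 => /h1_inj[[e1 e2 e3] [e4 e5 e6]].
have {}e4 : oconj (omul x2 x3) = (a2 + a3) *: x1 by apply/esym/eqP; rewrite -subr_eq0 e4.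
have {}e5 : oconj (omul x3 x1) = - (a3 + a1) *: x2.
  by rewrite scaleNr; apply/eqP; rewrite -addr_eq0 addrC e5.
have {}e6 : oconj (omul x1 x2) = - (a1 + a2) *: x3.
  by rewrite scaleNr; apply/eqP; rewrite -addr_eq0 addrC e6.
have n1 := odot_norm_omul x2 x3; have n2 := odot_norm_omul x3 x1.
have n3 := odot_norm_omul x1 x2.
have t1 := odot_cyc x1 x2 x3; have t2 := odot_cyc x2 x3 x1.
rewrite e4 odotZl odotZr in n1; rewrite e5 odotZl odotZr in n2.
rewrite e6 odotZl odotZr in n3; rewrite e4 e5 !odotZr in t1.
rewrite e5 e6 !odotZr in t2.
move: (odot_ge0 x1) (odot_ge0 x2) (odot_ge0 x3).
move: (odot x1 x1) (odot x2 x2) (odot x3 x3) e1 e2 e3 n1 n2 n3 t1 t2 => p q r.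
rewrite /trJ /h1; clear => e1 e2 e3 n1 n2 n3 t1 t2 p0 q0 r0.
have [r_eq0|r_neq0] := eqVneq r 0.
  have [a20 p_eq0] : a2 = 0 /\ p = 0.
    have sa := sqr_ge0 a2; split; last by lra.
    by apply/eqP; rewrite -sqrf_eq0; apply/eqP; lra.
  have [q_eq0|q_neq0] := eqVneq q 0.
    have a10 : a1 = 0 by apply/eqP; rewrite -sqrf_eq0; apply/eqP; lra.
    have a30 : a3 = 0 by apply/eqP; rewrite -sqrf_eq0; apply/eqP; lra.
    by lra.
  have /eqP : (a3 + a1) * q = 0 by move: t1; rewrite p_eq0; lra.
  by rewrite mulf_eq0 (negbTE q_neq0) orbF => /eqP; lra.
have [s0|s_neq0] := eqVneq (a1 + a2) 0.
  have pq : (p + q) * r = 0.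
    have T0 : (a2 + a3) * p = 0 by rewrite t1 t2 s0 oppr0 mul0r.
    have T0' : - (a3 + a1) * q = 0 by rewrite -t1.
    have qr0 : q * r = 0 by rewrite -n1 T0 mulr0.
    have rp0 : r * p = 0 by rewrite -n2 T0' mulr0.
    by lra.
  have /eqP pq0 : p + q == 0 by move/eqP: pq; rewrite mulf_eq0 (negbTE r_neq0) orbF.
  have a30 : a3 = 0 by apply/eqP; rewrite -sqrf_eq0; apply/eqP; lra.
  by lra.
have hp : p = (a3 + a1) * (a1 + a2).
  apply: (mulIf r_neq0); rewrite [p * r]mulrC -n2 t2; ring.
have hr : r = - ((a2 + a3) * (a3 + a1)).
  have hq : q = - ((a2 + a3) * (a1 + a2)) by apply: (mulIf r_neq0); rewrite -n1 t1 t2; ring.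
  apply: (mulfI s_neq0); apply: (mulfI s_neq0); rewrite hp hq in n3; lra.
(* With p and r substituted, the second diagonal equation reads (a1 + a2 + a3)^2 = 0. *)
apply/eqP; rewrite -sqrf_eq0; apply/eqP.
rewrite hp hr in e2; lra.
Qed.

(** For trace zero the equations of X^{x2} = 0 and of X o X = 0 are equivalent, and the latter
    forces trace zero by [jordan_sq0_tr]. Apart from one sign, the null cone is thus described by
    the Jordan product. *)
Lemma nullconeE (a1 a2 a3 : R) (x1 x2 x3 : oct) :
  nullcone R (h1 a1 a2 a3 x1 x2 x3) <->
  jordan (h1 a1 a2 a3 x1 x2 x3) (h1 a1 a2 a3 x1 x2 x3) = 0 /\ a1 < 0.
Proof.
have fE : formJ E1 (h1 a1 a2 a3 x1 x2 x3) = a1.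
  by rewrite /E1 formJE !odotE /=; ring.
split=> [[c t]|[s a10]].
- rewrite fE => a10; split=> //.
  move: c t; rewrite /cross2 {1}/h1 h10 => /h1_inj[[e1 e2 e3] [e4 e5 e6]] t.
  have {}t : a1 = - (a2 + a3) by move: t; rewrite /trJ /h1; lra.
  rewrite jordan_sqE; apply: J1_ext.
  + by rewrite t; nra.
  + by rewrite t in e3; nra.
  + by rewrite t in e2; nra.
  + by rewrite -e4 t; move: (oconj _) => y; generalize x1 y; clear; oct_ring.
  + apply/esym; rewrite -e5; have -> : a3 + a1 = - a2 by lra.
    by move: (oconj _) => y; generalize x2 y; clear; oct_ring.
  + apply/esym; rewrite -e6; have -> : a1 + a2 = - a3 by lra.
    by move: (oconj _) => y; generalize x3 y; clear; oct_ring.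
- have := jordan_sq0_tr s => t; split=> //; last by rewrite fE.
  move: s; rewrite jordan_sqE h10 => /h1_inj[[e1 e2 e3] [e4 e5 e6]].
  have {}t : a1 = - (a2 + a3) by move: t; rewrite /trJ /h1; lra.
  rewrite /cross2 {1}/h1; apply: J1_ext.
  + by rewrite t in e1; nra.
  + by rewrite t in e1 *; nra.
  + by rewrite t in e1 *; nra.
  + rewrite -e4 t; move: (oconj _) => y; generalize x1 y; clear; oct_ring.
  + apply/esym; rewrite -e5; have -> : a3 + a1 = - a2 by lra.
    by move: (oconj _) => y; generalize x2 y; clear; oct_ring.
  + apply/esym; rewrite -e6; have -> : a1 + a2 = - a3 by lra.
    by move: (oconj _) => y; generalize x3 y; clear; oct_ring.
Qed.
End NullCone.

(** * Transitivity of K on the rays *)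

Section Transitivity.
Variable R : realType.
Local Notation oct := (oct R).
Local Notation J1 := (J1 R).

Lemma nullcone_sq (X : J1) : nullcone R X -> jordan X X = 0.
Proof.
have [a1 [a2 [a3 [x1 [x2 [x3 ->]]]]]] := J1P X.
by case/nullconeE.
Qed.

Lemma nullcone_eqs (a1 a2 a3 : R) (x1 x2 x3 : oct) :
  nullcone R (h1 a1 a2 a3 x1 x2 x3) ->
  [/\ a1 < 0, a1 + a2 + a3 = 0, odot x1 x1 = a2 * a3,
      odot x2 x2 = - (a3 * a1) & odot x3 x3 = - (a1 * a2)] /\
  [/\ a1 *: x1 = - oconj (omul x2 x3), a2 *: x2 = oconj (omul x3 x1)
    & a3 *: x3 = oconj (omul x1 x2)].
Proof.
move=> n; have /nullconeE[_ a10] := n; move: n => [c t _].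
move: c; rewrite /cross2 {1}/h1 h10 => /h1_inj[[e1 e2 e3] [e4 e5 e6]].
split; [split; move: a10 t e1 e2 e3; rewrite /trJ /h1; clear; lra|split].
- by apply/esym/eqP; rewrite -subr_eq0 e4.
- by apply/esym/eqP; rewrite -subr_eq0 e5.
- by apply/esym/eqP; rewrite -subr_eq0 e6.
Qed.

(** Since a1 is nonzero, the null cone equations can be solved for a2, a3 and x1. Comparing two null
    vectors therefore takes only a1, x2 and x3. *)
Lemma nullcone_ext (a1 a2 a3 b1 b2 b3 : R) (x1 x2 x3 y1 y2 y3 : oct) :
  nullcone R (h1 a1 a2 a3 x1 x2 x3) -> nullcone R (h1 b1 b2 b3 y1 y2 y3) ->
  a1 = b1 -> x2 = y2 -> x3 = y3 -> h1 a1 a2 a3 x1 x2 x3 = h1 b1 b2 b3 y1 y2 y3.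
Proof.
move=> /nullcone_eqs[[a10 _ _ e2 e3] [e4 _ _]] /nullcone_eqs[[b10 _ _ f2 f3] [f4 _ _]].
move=> ab xy2 xy3; subst.
have b1n0 : b1 != 0 by rewrite lt_eqF.
apply: J1_ext => //.
- by apply: (mulfI b1n0); lra.
- by apply: (mulIf b1n0); lra.
- by apply: (scalerI b1n0); rewrite e4 f4.
Qed.

(** The cases are the signs of a1. If a1 = 0, the first diagonal equation kills x2 and x3, and the
    other two kill the rest. *)
Lemma sq0_nullcone (X : J1) : jordan X X = 0 ->
  [\/ X = 0, nullcone R X | nullcone R (- X)].
Proof.
move=> s; have sN : jordan (- X) (- X) = 0 by rewrite jordanNl jordanNr opprK.
move: s sN; have [a1 [a2 [a3 [x1 [x2 [x3 ->]]]]]] := J1P X => s sN.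
case: (ltgtP a1 0) => a10.
- by constructor 2; apply/nullconeE.
- by constructor 3; move: sN; rewrite h1N => sN; apply/nullconeE; rewrite oppr_lt0.
constructor 1; have := jordan_sq0_tr s => t.
move: s; rewrite jordan_sqE h10 => /h1_inj[[e1 e2 e3] _].
have q2 := odot_ge0 x2; have q3 := odot_ge0 x3; have q1 := odot_ge0 x1.
rewrite a10 in e1.
have z2 : odot x2 x2 = 0 by lra.
have z3 : odot x3 x3 = 0 by lra.
have s2 := sqr_ge0 a2; have s3 := sqr_ge0 a3.
have z1 : odot x1 x1 = 0 by lra.
apply: J1_ext; [done | | |exact: odot_eq0..].
- by apply/eqP; rewrite -sqrf_eq0; apply/eqP; lra.
- by apply/eqP; rewrite -sqrf_eq0; apply/eqP; lra.
Qed.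

Lemma nullconeZ r (X : J1) : 0 < r -> nullcone R X -> nullcone R (r *: X).
Proof.
move=> r0; have [a1 [a2 [a3 [x1 [x2 [x3 ->]]]]]] := J1P X.
move=> /nullconeE[s a10]; rewrite h1Z; apply/nullconeE; split; last by rewrite pmulr_rlt0.
by rewrite -h1Z jordanZl jordanZr s !scaler0.
Qed.

Lemma kmap_nullcone c b (X : J1) : c ^+ 2 + odot b b = 1 ->
  nullcone R X -> nullcone R (kmap c b X).
Proof.
move=> cb; have [a1 [a2 [a3 [x1 [x2 [x3 ->]]]]]] := J1P X.
move=> /nullconeE[s a10]; have := kmap_sq cb (h1 a1 a2 a3 x1 x2 x3).
rewrite s (linear_0E (@kmap_linear _ c b)) kmapE => sk.
by apply/nullconeE; split; [exact/esym|].
Qed.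

(** The left side is (y u) conj(u), and the alternative law replaces associativity. *)
Lemma omul_conj_absorbl (u y : oct) : oconj (omul u (oconj (omul y u))) = odot u u *: y.
Proof. by oct_ring. Qed.
Lemma omul_conj_absorbr (u y : oct) : oconj (omul (oconj (omul u y)) u) = odot u u *: y.
Proof. by oct_ring. Qed.

Definition onorm (y : oct) : R := Num.sqrt (odot y y).
Definition ounit (y : oct) : oct := (onorm y)^-1 *: y.

(* On the sphere of the pairs (x2, x3), [rot3 y2 y3] moves the point (0, 1) of P^- through
   (-1, 0) and (0, y3 / |y3|) to (y2, y3), and [rot2 y2 y3] moves it through
   (y2 / |y2|, 0). *)
Definition rot3 (y2 y3 : oct) (Z : J1) : J1 :=
  kmap (onorm y3) (- oconj (omul y2 (ounit y3)))
    (kmap 0 (- oconj (ounit y3)) (kmap 0 (oone R) Z)).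

Definition rot2 (y2 y3 : oct) (Z : J1) : J1 :=
  kmap (onorm y2) (oconj (omul (ounit y2) y3)) (kmap 0 (- oconj (ounit y2)) Z).

(** Division by -a1 puts (x2, x3) on the unit sphere, see [nullcone_sphere]. [sec3] and [sec2] are
    local sections over the charts where x3, respectively x2, is nonzero; the two charts cover the
    null cone. *)
Definition sec3 (X : J1) : J1 -> J1 :=
  rot3 ((- X.1.1.1.1.1)^-1 *: X.1.2) ((- X.1.1.1.1.1)^-1 *: X.2).

Definition sec2 (X : J1) : J1 -> J1 :=
  rot2 ((- X.1.1.1.1.1)^-1 *: X.1.2) ((- X.1.1.1.1.1)^-1 *: X.2).

Lemma unit_normalize (y : oct) : y != 0 ->
  [/\ onorm y != 0, onorm y ^+ 2 = odot y y, odot (ounit y) (ounit y) = 1 &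
      onorm y *: ounit y = y].
Proof.
move=> y0; have d0 := odot_gt0 y0; rewrite /ounit.
have n0 : onorm y != 0 by rewrite gt_eqF // sqrtr_gt0.
have n2 : onorm y ^+ 2 = odot y y by rewrite sqr_sqrtr // ltW.
split=> //; first by rewrite odotZl odotZr -n2; field.
by rewrite scalerA divff // scale1r.
Qed.

Lemma odot_one : odot (oone R) (oone R) = 1.
Proof. by rewrite odotE /=; ring. Qed.

Lemma nullcone_sphere (a1 a2 a3 : R) (x1 x2 x3 : oct) :
  nullcone R (h1 a1 a2 a3 x1 x2 x3) ->
  odot ((- a1)^-1 *: x2) ((- a1)^-1 *: x2)
  + odot ((- a1)^-1 *: x3) ((- a1)^-1 *: x3) = 1.
Proof.
move=> /nullcone_eqs[[a10 t _ e2 e3] _].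
rewrite !odotZl !odotZr e2 e3.
have -> : a2 = - a1 - a3 by lra.
by field; rewrite lt_eqF.
Qed.

Lemma sec3P (a1 a2 a3 : R) (x1 x2 x3 : oct) (X := h1 a1 a2 a3 x1 x2 x3) :
  nullcone R X -> x3 != 0 -> Ksub R (sec3 X) /\ - a1 *: sec3 X Pminus = X.
Proof.
move=> nX x30; have sph := nullcone_sphere nX.
have /nullcone_eqs[[a10 _ _ _ _] _] := nX.
have a1n0 : - a1 != 0 by rewrite oppr_eq0 lt_eqF.
rewrite /sec3 [X.1.1.1.1.1]/= [X.1.2]/= [X.2]/=.
have y3n0 : (- a1)^-1 *: x3 != 0 by rewrite scaler_eq0 invr_eq0 (negbTE a1n0).
have x2E : x2 = - a1 *: ((- a1)^-1 *: x2) by rewrite scalerA divff // scale1r.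
have x3E : x3 = - a1 *: ((- a1)^-1 *: x3) by rewrite scalerA divff // scale1r.
move: ((- a1)^-1 *: x2) ((- a1)^-1 *: x3) sph y3n0 x2E x3E => y2 y3 sph y3n0 x2E x3E.
have [n0 n2 u1 nu] := unit_normalize y3n0.
rewrite /rot3; move: (onorm y3) (ounit y3) n0 n2 u1 nu => n u n0 n2 u1 nu.
(* A single rotation moves (0, 1) to (-conj(b), c), whose second entry is real; the two rotations
   with c = 0 first give this entry the direction of y3. *)
have c1 : 0 ^+ 2 + odot (oone R) (oone R) = 1 by rewrite odot_one expr0n add0r.
have c2 : 0 ^+ 2 + odot (- oconj u) (- oconj u) = 1.
  by rewrite odotNl odotNr opprK odot_conj u1 expr0n add0r.
have c3 : n ^+ 2 + odot (- oconj (omul y2 u)) (- oconj (omul y2 u)) = 1.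
  by rewrite odotNl odotNr opprK odot_conj odot_omul u1 n2 mulr1 addrC.
split; first exact: (Ksub_comp (kmap_K c3) (Ksub_comp (kmap_K c2) (kmap_K c1))).
have := kmap_nullcone c3 (kmap_nullcone c2 (kmap_nullcone c1 (nullcone_Pminus R))).
rewrite /Pminus !kmapE => nP.
have {nP} := nullconeZ (_ : 0 < - a1) nP; rewrite oppr_gt0 => /(_ a10).
rewrite h1Z => nP.
apply: nullcone_ext nP nX _ _ _; first by rewrite mulrN1 opprK.
- rewrite x2E; congr (_ *: _).
  have -> : 0 *: (0 *: 0 - oconj (omul (oone R) (oone R))) - oconj
     (omul (0 *: oone R + oconj (omul (oone R) 0)) (- oconj u)) = 0.
    by generalize u; clear; oct_ring.
  have -> : 0 *: (0 *: oone R + oconj (omul (oone R) 0)) + oconj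
     (omul (- oconj u) (0 *: 0 - oconj (omul (oone R) (oone R)))) = u.
    by generalize u; clear; oct_ring.
  rewrite scaler0 add0r omulNr oconjN opprK omul_conj_absorbl u1 scale1r.
  by [].
- rewrite x3E; congr (_ *: _).
  have -> : 0 *: (0 *: 0 - oconj (omul (oone R) (oone R))) - oconj
     (omul (0 *: oone R + oconj (omul (oone R) 0)) (- oconj u)) = 0.
    by generalize u; clear; oct_ring.
  have -> : 0 *: (0 *: oone R + oconj (omul (oone R) 0)) + oconj
     (omul (- oconj u) (0 *: 0 - oconj (omul (oone R) (oone R)))) = u.
    by generalize u; clear; oct_ring.
  by rewrite omulx0 -nu; generalize n u; clear; oct_ring.
Qed.

Lemma sec2P (a1 a2 a3 : R) (x1 x2 x3 : oct) (X := h1 a1 a2 a3 x1 x2 x3) :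
  nullcone R X -> x2 != 0 -> Ksub R (sec2 X) /\ - a1 *: sec2 X Pminus = X.
Proof.
move=> nX x20; have sph := nullcone_sphere nX.
have /nullcone_eqs[[a10 _ _ _ _] _] := nX.
have a1n0 : - a1 != 0 by rewrite oppr_eq0 lt_eqF.
rewrite /sec2 [X.1.1.1.1.1]/= [X.1.2]/= [X.2]/=.
have y2n0 : (- a1)^-1 *: x2 != 0 by rewrite scaler_eq0 invr_eq0 (negbTE a1n0).
have x2E : x2 = - a1 *: ((- a1)^-1 *: x2) by rewrite scalerA divff // scale1r.
have x3E : x3 = - a1 *: ((- a1)^-1 *: x3) by rewrite scalerA divff // scale1r.
move: ((- a1)^-1 *: x2) ((- a1)^-1 *: x3) sph y2n0 x2E x3E => y2 y3 sph y2n0 x2E x3E.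
have [n0 n2 u1 nu] := unit_normalize y2n0.
rewrite /rot2; move: (onorm y2) (ounit y2) n0 n2 u1 nu => n u n0 n2 u1 nu.
have c2 : 0 ^+ 2 + odot (- oconj u) (- oconj u) = 1.
  by rewrite odotNl odotNr opprK odot_conj u1 expr0n add0r.
have c3 : n ^+ 2 + odot (oconj (omul u y3)) (oconj (omul u y3)) = 1.
  by rewrite odot_conj odot_omul u1 n2 mul1r.
split; first exact: (Ksub_comp (kmap_K c3) (kmap_K c2)).
have := kmap_nullcone c3 (kmap_nullcone c2 (nullcone_Pminus R)).
rewrite /Pminus !kmapE => nP.
have {nP} := nullconeZ (_ : 0 < - a1) nP; rewrite oppr_gt0 => /(_ a10).
rewrite h1Z => nP.
have e2 : 0 *: 0 - oconj (omul (oone R) (- oconj u)) = u.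
  by generalize u; clear; oct_ring.
have e3 : 0 *: oone R + oconj (omul (- oconj u) 0) = 0.
  by generalize u; clear; oct_ring.
apply: nullcone_ext nP nX _ _ _; first by rewrite mulrN1 opprK.
- rewrite x2E; congr (_ *: _); rewrite e2 e3 omul0x -nu.
  by generalize u n; clear; oct_ring.
- rewrite x3E; congr (_ *: _); rewrite e2 e3.
  rewrite scaler0 add0r omul_conj_absorbr u1 scale1r.
  by [].
Qed.
End Transitivity.

(** * Automorphisms preserve the null cone *)

(** In [F4_nullcone], [k] and [p] are the images k P and P: if g maps the ray of k P to minus the
    ray of l P, then l^-1 g k sends P to a negative multiple of itself. *)
Lemma linear_cancel_scale (R : realType) (V : lmodType R) (g l l' : V -> V) r s x p k :
  linear g -> linear l -> cancel l l' -> 0 < r ->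
  x = r *: k -> - g x = s *: l p -> l' (g k) = - (s / r) *: p.
Proof.
move=> lg ll lK r0 ->; rewrite (linear_scaleE lg) => e.
have -> : g k = l (- (s / r) *: p); last by rewrite lK.
apply: (scalerI (lt0r_neq0 r0)); rewrite (linear_scaleE ll) scalerA.
by rewrite mulrN mulrC divfK ?lt0r_neq0 // scaleNr -e opprK.
Qed.

Lemma linear_form_comb (R : realType) (V W : lmodType R) (d : W -> R) (h : V -> W) :
  {morph d : x y / x + y} -> (forall r x, d (r *: x) = r * d x) -> linear h ->
  forall s t u v, d (h (s *: u + t *: v)) = s * d (h u) + t * d (h v).
Proof.
by move=> dD dZ lh s t u v; rewrite (linear_addE lh) !(linear_scaleE lh) dD !dZ.
Qed.

Section Invariance.
Variable R : realType.
Local Notation oct := (oct R).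
Local Notation J1 := (J1 R).
Local Notation P := (@Pminus R).

(* The linear form (P^-|X). *)
Definition formP (X : J1) : R := let: (a1, a2, _, _, _, x3) := X in - a1 + a2 - 2 * oRe x3.

Lemma formPE (a1 a2 a3 : R) (x1 x2 x3 : oct) :
  formP (h1 a1 a2 a3 x1 x2 x3) = - a1 + a2 - 2 * oRe x3.
Proof. by []. Qed.

(** This recovers (P^-|X) from the Jordan product alone, so an automorphism that scales P^-
    transforms this form in a known way. *)
Lemma jordan_Pminus (X : J1) : jordan P (jordan P X) = (formP X / 2) *: P.
Proof.
have [a1 [a2 [a3 [x1 [x2 [x3 ->]]]]]] := J1P X.
rewrite formPE /Pminus !jordanE h1Z.
apply: J1_ext; last first.
- by generalize a1 a2 a3 x1 x2 x3; clear; rewrite /oRe; oct_field.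
- by generalize a1 a2 a3 x1 x2 x3; clear; rewrite /oRe; oct_field.
- by generalize a1 a2 a3 x1 x2 x3; clear; rewrite /oRe; oct_field.
all: by generalize a1 a2 a3 x1 x2 x3; clear; rewrite /oRe; oct_coord; oct_simpl; field.
Qed.

Lemma Pminus_neq0 : P != 0.
Proof.
apply/eqP; rewrite /Pminus h10 => /h1_inj[[/eqP + _ _] _].
by rewrite oppr_eq0 oner_eq0.
Qed.

Lemma F4_formP (g : J1 -> J1) r X : F4 R g -> r != 0 -> g P = r *: P ->
  formP (g X) = formP X / r.
Proof.
move=> Fg r0 gP; have [_ _ gj] := Fg.
have := congr1 g (jordan_Pminus X); rewrite F4Z // !gj gP.
rewrite jordanZl jordanZl jordanZr jordan_Pminus !scalerA.
move=> /eqP; rewrite -subr_eq0 -scalerBl scaler_eq0 (negbTE Pminus_neq0) orbF.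
rewrite subr_eq0 => /eqP e; apply: (mulfI r0); apply: (mulfI r0); move: e.
set u := formP (g X); set v := formP X => e.
have -> : r * (r * (v / r)) = v * r by field.
lra.
Qed.

(** The source of the signature (9, 1): the product of two independent linear forms contributes (1,
    1), and the norm of x1 - conj(x2) contributes eight positive squares. *)
Lemma formP_sq (a1 a2 a3 : R) (x1 x2 x3 : oct) :
  formP (jordan (h1 a1 a2 a3 x1 x2 x3) (h1 a1 a2 a3 x1 x2 x3)) = (a1 + a2) * (a2 - a1 - 2 * oRe x3)
    + odot (x1 - oconj x2) (x1 - oconj x2).
Proof.
rewrite jordan_sqE formPE.
by generalize a1 a2 a3 x1 x2 x3; clear; rewrite /oRe; dot_ring.
Qed.

Lemma formPZ r (X : J1) : formP (r *: X) = r * formP X.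
Proof.
have [a1 [a2 [a3 [x1 [x2 [x3 ->]]]]]] := J1P X.
rewrite h1Z !formPE; generalize x3; clear; rewrite /oRe; dot_ring.
Qed.

(** One factor of the indefinite term of [formP_sq]; on its kernel only the sum of squares
    remains. *)
Definition diag12 (X : J1) : R := let: (a1, a2, _, _, _, _) := X in a1 + a2.

Lemma diag12D (X Y : J1) : diag12 (X + Y) = diag12 X + diag12 Y.
Proof.
have [a1 [a2 [a3 [x1 [x2 [x3 ->]]]]]] := J1P X.
have [b1 [b2 [b3 [y1 [y2 [y3 ->]]]]]] := J1P Y.
by rewrite h1D /diag12 /h1; ring.
Qed.
Lemma diag12Z r (X : J1) : diag12 (r *: X) = r * diag12 X.
Proof.
have [a1 [a2 [a3 [x1 [x2 [x3 ->]]]]]] := J1P X.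
by rewrite h1Z /diag12 /h1; ring.
Qed.

Lemma formP_sq_ge0 (X : J1) : diag12 X = 0 -> 0 <= formP (jordan X X).
Proof.
have [a1 [a2 [a3 [x1 [x2 [x3 ->]]]]]] := J1P X.
by rewrite formP_sq /diag12 /h1 => ->; rewrite mul0r add0r odot_ge0.
Qed.

Lemma diag12_F4 (h : J1 -> J1) s t (U V : J1) : F4 R h ->
  diag12 (h (s *: U + t *: V)) = s * diag12 (h U) + t * diag12 (h V).
Proof.
by case=> lh _ _; exact: (linear_form_comb diag12D diag12Z lh).
Qed.

(* The quadratic form X |-> (P|X o X) is nonnegative on the hyperplane
   [diag12 X = 0] and positive on the 8-dimensional space of the x1-coordinate,
   whereas [h] would reverse its sign. *)
Lemma F4_not_neg (h : J1 -> J1) c : F4 R h -> 0 < c -> h P <> - c *: P.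
Proof.
move=> Fh c0 hP; have [_ _ hj] := Fh.
have nc0 : - c != 0 by rewrite oppr_eq0 gt_eqF.
(* A plane inside the x1-coordinate suffices: the linear form [diag12] composed with [h] vanishes at
   some nonzero vector of it. *)
have [Y posY YE] : exists2 Y : R -> R -> J1,
    forall s t, formP (jordan (Y s t) (Y s t)) = s ^+ 2 + t ^+ 2
    & forall s t, Y s t = s *: Y 1 0 + t *: Y 0 1.
  exists (fun s t => h1 0 0 0 (((s, t), (0, 0)), 0) 0 0) => s t.
    by rewrite formP_sq; generalize s t; clear; rewrite /oRe; dot_ring.
  rewrite !h1Z h1D; apply: J1_ext; try by generalize s t; clear; oct_ring.
  1-3: by rewrite !mulr0 addr0.
have neg X : formP (jordan X X) > 0 -> diag12 (h X) = 0 -> False.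
  move=> Xpos; have := F4_formP (jordan X X) Fh nc0 hP; rewrite hj.
  move=> e d; have := formP_sq_ge0 d; rewrite e invrN mulrN oppr_ge0 leNgt => /negP; apply.
  by rewrite divr_gt0.
have [z1|nz1] := eqVneq (diag12 (h (Y 1 0))) 0.
  by apply: neg z1; rewrite posY expr1n expr0n addr0.
apply: (neg (Y (- diag12 (h (Y 0 1))) (diag12 (h (Y 1 0))))).
  by rewrite posY ltr_wpDl ?sqr_ge0 // lt_neqAle sqr_ge0 eq_sym sqrf_eq0 nz1.
by rewrite YE diag12_F4 // mulNr mulrC addNr.
Qed.

Lemma nullcone_Ktrans (X : J1) : nullcone R X ->
  exists k r, [/\ Ksub R k, 0 < r & X = r *: k P].
Proof.
have [a1 [a2 [a3 [x1 [x2 [x3 ->]]]]]] := J1P X => nX.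
have /nullconeE[_ a10] := nX.
have [x30|x30] := eqVneq x3 0; last first.
  by have [K e] := sec3P nX x30; exists (sec3 (h1 a1 a2 a3 x1 x2 x3)), (- a1); rewrite e oppr_gt0.
have [x20|x20] := eqVneq x2 0; last first.
  by have [K e] := sec2P nX x20; exists (sec2 (h1 a1 a2 a3 x1 x2 x3)), (- a1); rewrite e oppr_gt0.
have := nullcone_sphere nX; rewrite x20 x30 !scaler0 !odotE /= => /eqP.
by rewrite !mulr0 !addr0 eq_sym oner_eq0.
Qed.

Lemma bij_inv (g : J1 -> J1) : bijective g -> exists g', cancel g g' /\ cancel g' g.
Proof. by case=> g' *; exists g'. Qed.

Lemma F4_nullcone (g : J1 -> J1) X : F4 R g -> nullcone R X -> nullcone R (g X).
Proof.
move=> Fg nX; have [lg bg gj] := Fg.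
have gX2 : jordan (g X) (g X) = 0 by rewrite -gj nullcone_sq // F4_0.
have X0 : X <> 0.
  by move=> X0; move: nX; rewrite X0 h10 => /nullconeE[_]; rewrite ltxx.
case: (sq0_nullcone gX2) => [gX0|nn|ngX]; [|exact: nn|].
  by case: X0; apply: (bij_inj bg); rewrite gX0 (F4_0 Fg).
have [k [r [Kk r0 eX]]] := nullcone_Ktrans nX.
have [l [s [[Fl sl] s0 eY]]] := nullcone_Ktrans ngX.
have [l' [lK l'K]] := bij_inv (let: And3 _ bl _ := Fl in bl).
have Fl' := F4_inv Fl lK l'K.
have Fh := F4_comp Fl' (F4_comp Fg Kk.1).
case: (F4_not_neg Fh (divr_gt0 s0 r0)).
exact: (linear_cancel_scale lg (let: And3 ll _ _ := Fl in ll) lK r0 eX eY).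
Qed.
End Invariance.

(** * Stabilizers in K *)

Lemma scaler_inj (R : realType) (V : lmodType R) (v : V) r s :
  v <> 0 -> r *: v = s *: v -> r = s.
Proof.
move=> /eqP v0 /eqP; rewrite -subr_eq0 -scalerBl scaler_eq0 (negbTE v0) orbF subr_eq0.
by move/eqP.
Qed.

Section FixedElements.
Variables (R : realType) (V : lmodType R) (m : V -> V -> V) (h : V -> V).
Hypotheses (lh : linear h) (hm : forall x y, h (m x y) = m (h x) (h y)).

Let hD x y : h (x + y) = h x + h y. Proof. exact: linear_addE lh x y. Qed.
Let hN x : h (- x) = - h x. Proof. exact: linear_oppE lh x. Qed.
Let hZ r x : h (r *: x) = r *: h x. Proof. exact: linear_scaleE lh r x. Qed.

Lemma fixed_idempotent r p q : h p = p -> h q = q ->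
  h (r *: (m p q - (p + q))) = r *: (m p q - (p + q)).
Proof. by move=> hp hq; rewrite hZ hD hN hm hD hp hq. Qed.

Lemma fixed_sub r p q : h p = p -> h q = q -> h (r *: (p - q)) = r *: (p - q).
Proof. by move=> hp hq; rewrite hZ hD hN hp hq. Qed.

Lemma commute_reflection r e x : h e = e ->
  h (x + r *: (m e (m e x) - m e x)) = h x + r *: (m e (m e (h x)) - m e (h x)).
Proof. by move=> he; rewrite hD hZ hD hN !hm !he. Qed.

Lemma commute_inner_derivation r e f x : h e = e -> h f = f ->
  h (r *: (m e (m f x) - m f (m e x))) = r *: (m e (m f (h x)) - m f (m e (h x))).
Proof. by move=> he hf; rewrite hZ hD hN !hm !he !hf. Qed.

Lemma fixed_commutant r (a : V -> V) e : (forall x, h (a x) = a (h x)) -> h e = e ->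
  h (r *: a (a e) - a e) = r *: a (a e) - a e.
Proof. by move=> ha he; rewrite hD hN hZ !ha he. Qed.

Lemma commute_quadratic r e x : h e = e ->
  h (r *: m e (m e x) - m e x) = r *: m e (m e (h x)) - m e (h x).
Proof. by move=> he; rewrite hD hZ hN !hm !he. Qed.

End FixedElements.

Section StabilizerK.
Variable R : realType.
Local Notation oct := (oct R).
Local Notation J1 := (J1 R).
Local Notation P := (@Pminus R).
Local Notation Q := (sigmaJ (@Pminus R)).

Definition F31 : J1 := h1 0 0 0 0 0 (oone R).

Lemma QE : Q = h1 (-1) 1 0 0 0 (- oone R).
Proof. by rewrite /Pminus sigmaJE oppr0. Qed.

(** With E_2 the second diagonal idempotent, P o Q = 2 (E_1 + E_2) and P + Q = 2 (E_2 - E_1). *)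
Lemma E1_PQ : E1 = 4^-1 *: (jordan P Q - (P + Q)) :> J1.
Proof.
rewrite QE /Pminus jordanE h1D h1N h1D h1Z /E1; apply: J1_ext; last first.
1-3: by clear; oct_field.
all: by clear; oct_coord; oct_simpl; field.
Qed.

Lemma F31_PQ : F31 = 2^-1 *: (P - Q).
Proof.
rewrite QE /Pminus h1N h1D h1Z /F31; apply: J1_ext; last first.
1-3: by clear; oct_field.
all: by field.
Qed.

Lemma jordan_E1 (a1 a2 a3 : R) (x1 x2 x3 : oct) :
  jordan E1 (h1 a1 a2 a3 x1 x2 x3) = h1 a1 0 0 0 (2^-1 *: x2) (2^-1 *: x3).
Proof.
rewrite /E1 jordanE; apply: J1_ext; last first.
1-3: by generalize a1 a2 a3 x1 x2 x3; clear; oct_field.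
all: by generalize a1 a2 a3 x1 x2 x3; clear; oct_coord; oct_simpl; field.
Qed.

Lemma jordan_F31 (a1 a2 a3 : R) (x1 x2 x3 : oct) :
  jordan F31 (h1 a1 a2 a3 x1 x2 x3) =
  h1 (- oRe x3) (- oRe x3) 0 (- (2^-1 *: oconj x2)) (2^-1 *: oconj x1)
     ((2^-1 * (a1 + a2)) *: oone R).
Proof.
rewrite /F31 jordanE; apply: J1_ext; last first.
1-3: by generalize a1 a2 a3 x1 x2 x3; clear; oct_field.
all: by generalize a1 a2 a3 x1 x2 x3; clear; rewrite /oRe; oct_coord; oct_simpl; field.
Qed.

(** Peirce decomposition: L(E_1) has eigenvalues 0 and 1 on the part fixed by sigma and 1/2 on the
    entries x2, x3. There L^2 - L = -1/4, so the factor 8 yields the reflection. *)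
Lemma sigmaJ_E1 X : sigmaJ X = X + 8 *: (jordan E1 (jordan E1 X) - jordan E1 X) :> J1.
Proof.
have [a1 [a2 [a3 [x1 [x2 [x3 ->]]]]]] := J1P X.
rewrite sigmaJE !jordan_E1 h1N h1D h1Z h1D; apply: J1_ext; last first.
1-3: by generalize x1 x2 x3; clear; oct_field.
all: by field.
Qed.

Lemma tA3E (a : oct) (a1 a2 a3 : R) (x1 x2 x3 : oct) :
  tA3 a (h1 a1 a2 a3 x1 x2 x3) =
  h1 (- (2 * odot a x3)) (2 * odot a x3) 0
     (oconj (omul x2 a)) (oconj (omul a x1)) (- ((a1 - a2) *: a)).
Proof. by []. Qed.

Lemma tA3_inner X : tA3 (oone R) X =
  4 *: (jordan E1 (jordan F31 X) - jordan F31 (jordan E1 X)).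
Proof.
have [a1 [a2 [a3 [x1 [x2 [x3 ->]]]]]] := J1P X.
rewrite !(jordan_F31, jordan_E1) h1N h1D h1Z tA3E; apply: J1_ext; last first.
1-3: by generalize a1 a2 a3 x1 x2 x3; clear; oct_field.
all: by generalize a1 a2 a3 x1 x2 x3; clear; rewrite /oRe; oct_coord; oct_simpl; field.
Qed.

Lemma F4_fix_Msub (h : J1 -> J1) : F4 R h -> h P = P -> h Q = Q -> Msub R h.
Proof.
move=> Fh hP hQ; have [lh bh hj] := Fh.
have hE : h E1 = E1 by rewrite E1_PQ; exact: (fixed_idempotent lh hj _ hP hQ).
have hF : h F31 = F31 by rewrite F31_PQ; exact: (fixed_sub lh _ hP hQ).
have hs X : h (sigmaJ X) = sigmaJ (h X).
  by rewrite (sigmaJ_E1 X) (sigmaJ_E1 (h X)); exact: (commute_reflection lh hj _ _ hE).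
have [h' [hK h'K]] := bij_inv bh.
split; [split=> [//|]|exists h'; split=> //].
  by apply/funext => X; rewrite -[LHS]/(sigmaJ (h (sigmaJ X))) hs sigmaJK.
apply/funext => X; rewrite -[LHS]/(h (tA3 _ (h' X))) tA3_inner.
rewrite (commute_inner_derivation lh hj _ _ hE hF) h'K.
by rewrite -tA3_inner.
Qed.

Lemma Ksub_sigma (k : J1 -> J1) X : Ksub R k -> k (sigmaJ X) = sigmaJ (k X).
Proof. by case=> _ {2}<-; rewrite /= sigmaJK. Qed.

Lemma sigmaJ_fixed (X : J1) : sigmaJ X = X ->
  exists a1 a2 a3 x1, X = h1 a1 a2 a3 x1 0 0.
Proof.
have [a1 [a2 [a3 [x1 [x2 [x3 ->]]]]]] := J1P X.
rewrite sigmaJE => /h1_inj[_ [_ e2 e3]].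
have z (x : oct) : - x = x -> x = 0.
  move/eqP; rewrite eq_sym -addr_eq0 -mulr2n -scaler_nat scaler_eq0 pnatr_eq0 /=.
  exact/eqP.
by exists a1, a2, a3, x1; rewrite (z _ e2) (z _ e3).
Qed.

Lemma jordan_fixed (a1 a2 a3 b1 b2 b3 : R) (x y : oct) :
  jordan (h1 a1 a2 a3 x 0 0) (h1 b1 b2 b3 y 0 0) =
  h1 (a1 * b1) (a2 * b2 + odot x y) (a3 * b3 + odot x y)
     (2^-1 *: ((a2 + a3) *: y + (b2 + b3) *: x)) 0 0.
Proof.
rewrite jordanE; apply: J1_ext; last first.
1-3: by generalize x y; clear; oct_field.
all: by generalize x y; clear; dot_ring.
Qed.

(** The algebra fixed by sigma is the sum of R E_1 and a spin factor. If z1 is nonzero, testing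
    against E_1 gives Z = E_1. Otherwise Z lies in the spin factor, and testing against E_2 and
    against the element with x1 = 1 gives Z = 0. *)
Lemma central_idempotent_E1 (z1 z2 z3 : R) (w : oct) :
  h1 z1 z2 z3 w 0 0 <> 0 ->
  z1 * z1 = z1 -> z2 * z2 + odot w w = z2 -> z3 * z3 + odot w w = z3 ->
  (forall (b1 b2 b3 : R) (y : oct), exists r,
    [/\ z1 * b1 = r * z1, z2 * b2 + odot w y = r * z2, z3 * b3 + odot w y = r * z3 &
        2^-1 *: ((z2 + z3) *: y + (b2 + b3) *: w) = r *: w]) ->
  h1 z1 z2 z3 w 0 0 = E1.
Proof.
move=> Zn0 i1 i2 i3 ZYc.
have dw0 : odot w 0 = 0 by generalize w; clear; dot_ring.
have wP (r : R) : r != 2^-1 -> 2^-1 *: ((z2 + z3) *: 0 + 1 *: w) = r *: w -> w = 0.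
  move=> r2 e; apply/eqP; have : (2^-1 - r) *: w = 0.
    by rewrite scalerBl -e scaler0 add0r scale1r subrr.
  by move/eqP; rewrite scaler_eq0 subr_eq0 eq_sym (negbTE r2).
have [z10|z1n0] := eqVneq z1 0; last first.
  have [r [e1 e2 e3 e4]] := ZYc 1 0 0 0.
  have r1 : r = 1 by apply: (mulIf z1n0); rewrite -e1 mulrC.
  rewrite r1 dw0 ?mulr0 ?addr0 ?mul1r in e2.
  rewrite r1 dw0 ?mulr0 ?addr0 ?mul1r in e3; rewrite r1 in e4.
  have w0 : w = 0.
    by move: e4; rewrite scaler0 ?addr0 scale0r ?addr0 scaler0 scale1r => <-.
  rewrite w0 -e2; apply: J1_ext; [|by []|by rewrite -e3|by []..].
  by apply: (mulIf z1n0); rewrite mul1r.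
exfalso.
have w0 : w = 0.
  have [r [_ e2 e3 e4]] := ZYc 0 1 0 0; rewrite addr0 in e4.
  have [r2|r2] := eqVneq r 2^-1; last exact: wP r2 e4.
  rewrite r2 dw0 in e2.
  have z20 : z2 = 0 by move: e2; clear; lra.
  by apply: odot_eq0; move: i2; rewrite z20 mul0r add0r.
have [r [_ _ _]] := ZYc 0 0 0 (oone R).
rewrite w0 addr0 scale0r addr0 scaler0 scalerA => /eqP.
rewrite scaler_eq0 mulf_eq0 invr_eq0 pnatr_eq0 /= => /orP[/eqP z23|/eqP one0]; last first.
  have := odot_one R; rewrite one0 odotE /= => /eqP.
  by rewrite !mulr0 !addr0 eq_sym oner_eq0.
have dww : odot w w = 0 by rewrite {2}w0 dw0.
have [z20 z30] : z2 = 0 /\ z3 = 0.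
  move: i2 i3 (sqr_ge0 z2) (sqr_ge0 z3) z23; rewrite dww !expr2; clear.
  by split; lra.
by apply: Zn0; rewrite z10 z20 z30 w0.
Qed.

Lemma E1_neq0 : E1 <> 0 :> J1.
Proof. by rewrite /E1 h10 => /h1_inj[[/eqP]]; rewrite oner_eq0. Qed.

(* Among the idempotents Z fixed by sigma, E1 is the only one for which Z o Y is
   a multiple of Z for every Y fixed by sigma. *)
Lemma Ksub_E1 (k : J1 -> J1) : Ksub R k -> k E1 = E1.
Proof.
move=> Kk; have [Fk _] := Kk; have [lk bk kj] := Fk.
have [k' [kK k'K]] := bij_inv bk.
have E1s : sigmaJ E1 = E1 :> J1 by rewrite /E1 sigmaJE oppr0.
have Zs : sigmaJ (k E1) = k E1 by rewrite -Ksub_sigma // E1s.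
have Zn0 : k E1 <> 0 by rewrite -(F4_0 Fk) => /(can_inj kK) /E1_neq0.
have E1E1 : jordan E1 E1 = E1 :> J1 by rewrite {2}/E1 jordan_E1 !scaler0.
have ZZ : jordan (k E1) (k E1) = k E1 by rewrite -kj E1E1.
have E1Y (b1 b2 b3 : R) y : jordan E1 (h1 b1 b2 b3 y 0 0) = b1 *: E1.
  by rewrite jordan_E1 /E1 h1Z !scaler0 mulr1 mulr0.
have ZY Y : sigmaJ Y = Y -> exists r, jordan (k E1) Y = r *: k E1.
  move=> sY; have sY' : sigmaJ (k' Y) = k' Y.
    by apply: (can_inj kK); rewrite Ksub_sigma // k'K.
  have [b1 [b2 [b3 [y e]]]] := sigmaJ_fixed sY'.
  exists b1; have YE : Y = k (h1 b1 b2 b3 y 0 0) by rewrite -e k'K.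
  by rewrite YE -kj E1Y (F4Z _ _ Fk).
move: Zn0 ZZ ZY; have [z1 [z2 [z3 [w ->]]]] := sigmaJ_fixed Zs.
rewrite jordan_fixed => Zn0 /h1_inj[[i1 i2 i3] _] ZY.
apply: central_idempotent_E1 => // b1 b2 b3 y.
have [|r] := ZY (h1 b1 b2 b3 y 0 0); first by rewrite sigmaJE oppr0.
by rewrite jordan_fixed h1Z => /h1_inj[[? ? ?] [? _ _]]; exists r.
Qed.

(** A map that fixes E_1 and commutes with tA3 1 must fix P^-, since P^- is built from these two. *)
Lemma Pminus_tA3 : P = - 2^-1 *: tA3 (oone R) (tA3 (oone R) E1) - tA3 (oone R) E1.
Proof.
rewrite /E1 !tA3E h1Z h1N h1D /Pminus; apply: J1_ext; last first.
1-3: by clear; oct_field.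
all: by clear; oct_coord; oct_simpl; field.
Qed.

Lemma Msub_Pminus (k : J1 -> J1) : Msub R k -> k P = P.
Proof.
case=> Kk [k' [kK k'K kA]]; have [Fk _] := Kk.
have kAE X : k (tA3 (oone R) X) = tA3 (oone R) (k X).
  by rewrite -[in RHS]kA /= kK.
have [lk _ _] := Fk; rewrite Pminus_tA3.
exact: (fixed_commutant lk (- 2^-1) kAE (Ksub_E1 Kk)).
Qed.

(** The polynomial 2 L^2 - L is 1 at the eigenvalue 1 of L(E_1) and 0 at 1/2 and 0, hence is the
    projection onto the line of E_1. It carries (E_1|X) without any invariance of the trace. *)
Lemma peirce1_E1 X : 2 *: jordan E1 (jordan E1 X) - jordan E1 X = formJ E1 X *: E1 :> J1.
Proof.
have [a1 [a2 [a3 [x1 [x2 [x3 ->]]]]]] := J1P X.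
rewrite !jordan_E1 /E1 formJE !h1Z h1N h1D; apply: J1_ext; last first.
1-3: by generalize a1 a2 a3 x1 x2 x3; clear; oct_field.
all: by generalize a1 a2 a3 x1 x2 x3; clear; oct_coord; oct_simpl; field.
Qed.

Lemma Ksub_formE1 (k : J1 -> J1) X : Ksub R k -> formJ E1 (k X) = formJ E1 X.
Proof.
move=> Kk; have [Fk _] := Kk; have [lk _ kj] := Fk.
have e : k (formJ E1 X *: E1) = formJ E1 (k X) *: E1.
  exact: etrans (congr1 k (esym (peirce1_E1 X)))
    (etrans (commute_quadratic lk kj 2 X (Ksub_E1 Kk)) (peirce1_E1 (k X))).
have e' : k (formJ E1 X *: E1) = formJ E1 X *: E1.
  exact: etrans (F4Z _ _ Fk) (congr1 _ (Ksub_E1 Kk)).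
exact: scaler_inj E1_neq0 (etrans (esym e) e').
Qed.

Lemma Ksub_stab_Msub (k : J1 -> J1) r : Ksub R k -> k P = r *: P -> Msub R k.
Proof.
move=> Kk kP; have [Fk _] := Kk.
(* Invariance of (E_1|X) under K compares the values -r and -1, so r = 1. *)
have kP1 : k P = P.
  have := Ksub_formE1 P Kk; rewrite kP => e.
  have -> : r = 1; last by rewrite scale1r.
  move: e; rewrite /E1 /Pminus h1Z !formJE; generalize r; clear.
  by move=> r; rewrite !odotE; oct_simpl => e; lra.
by apply: F4_fix_Msub; rewrite ?Ksub_sigma // kP1.
Qed.

End StabilizerK.

(** * Exponentials of linear maps *)

Section ExponentialSeries.
Variables (R : realType) (V : normedModType R).
Implicit Types (f : V -> V).

(** The series of [expL] over an arbitrary normed module, so that the arguments about exponentials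
    do not see the coordinates of [J1]. *)
Definition expV f (x : V) : V := limn (series (fun n => (n`!%:R)^-1 *: iter n f x)).

Lemma expV_cvg (f : V -> V) (x y : V) :
  series (fun n => (n`!%:R)^-1 *: iter n f x) n @[n --> \oo] --> y -> expV f x = y.
Proof. by move=> h; apply: cvg_lim h; exact: norm_hausdorff. Qed.

Lemma exp_eigen (I : finType) f (l : I -> R) (v : I -> V) : linear f ->
  (forall i, f (v i) = l i *: v i) ->
  expV f (\sum_i v i) = \sum_i expR (l i) *: v i.
Proof.
move=> lf fv.
have fsum (w : I -> V) : f (\sum_i w i) = \sum_i f (w i).
  exact: (big_morph f (linear_addE lf) (linear_0E lf)).
have itE n : iter n f (\sum_i v i) = \sum_i l i ^+ n *: v i.
  elim: n => [|n IH]; first by apply: eq_bigr => i _; rewrite expr0 scale1r.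
  rewrite iterS IH fsum; apply: eq_bigr => i _.
  by rewrite (linear_scaleE lf) fv scalerA exprSr.
apply: expV_cvg.
have -> : series (fun n => (n`!%:R)^-1 *: iter n f (\sum_i v i)) =
    fun n => \sum_i (series (exp_coeff (l i)) n) *: v i.
  apply/funext => n; rewrite /series /=.
  under [RHS]eq_bigr do rewrite scaler_suml.
  rewrite exchange_big /=; apply: eq_bigr => k _.
  rewrite itE scaler_sumr; apply: eq_bigr => i _.
  by rewrite scalerA mulrC.
apply: cvg_big => [|i _]; first exact: add_continuous.
apply: cvgZr_tmp; exact: is_cvg_series_exp_coeff.
Qed.

Lemma exp_nilpotent N f x : linear f -> iter N f x = 0 ->
  expV f x = \sum_(n < N) (n`!%:R)^-1 *: iter n f x.
Proof.
move=> lf fN; apply: expV_cvg; apply: cvg_near_cst; exists N => // n /= Nn.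
rewrite /series /= (big_cat_nat (leq0n N) Nn) /= [X in _ + X]big_nat_cond.
rewrite [X in _ + X]big1 ?addr0 ?big_mkord // => k /andP[/andP[Nk _] _].
rewrite -(subnK Nk) iterD fN.
suff -> : iter (k - N) f 0 = 0 by rewrite scaler0.
by elim: (k - N)%N => // j IH; rewrite iterS IH linear_0E.
Qed.

End ExponentialSeries.

Section Antidiagonals.
Variables (V : zmodType) (N : nat) (F : nat -> nat -> V).
Hypothesis F0 : forall i j, (N <= i)%N || (N <= j)%N -> F i j = 0.

(** The Cauchy product for finite sums: the first 2N antidiagonals cover the N by N square, outside
    which all terms vanish. *)
Lemma sum_antidiagonals : \sum_(n < N + N) \sum_(i < n.+1) F i (n - i) =
  \sum_(i < N) \sum_(j < N) F i j.
Proof.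
transitivity (\sum_(n < N + N) \sum_(i < N | (i <= n)%N) F i (n - i)).
  apply: eq_bigr => n _.
  rewrite (big_ord_widen (N + N) (fun i => F i (n - i)%N)) //.
  rewrite [RHS](big_ord_widen_cond (N + N) (fun i => (i <= n)%N)
    (fun i => F i (n - i)%N)) ?leq_addr //.
  rewrite [LHS]big_mkcond [RHS]big_mkcond; apply: eq_bigr => i _ /=; rewrite ltnS.
  by case: ltnP => [_|Ni]; rewrite ?andbT ?andbF //; case: ifP => // _; rewrite F0 ?Ni.
rewrite (exchange_big_dep xpredT) //=; apply: eq_bigr => i _.
rewrite -(big_mkord (fun n => (i <= n)%N) (fun n => F i (n - i)%N)).
rewrite (big_cat_nat (leq0n i)) /=; last by rewrite (leq_trans (ltnW (ltn_ord i))) ?leq_addr.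
rewrite [X in X + _]big_nat_cond [X in X + _]big1 ?add0r; last first.
  by move=> k /andP[/andP[_ ki] ik]; move: (leq_ltn_trans ik ki); rewrite ltnn.
have := big_addn 0 (N + N) i (fun j => (i <= j)%N) (fun j => F i (j - i)%N).
rewrite add0n => ->.
have iN : (N <= N + N - i)%N by rewrite -addnBA ?leq_addr // ltnW.
rewrite (big_cat_nat (leq0n N) iN) /= [X in _ + X]big_nat_cond [X in _ + X]big1 ?addr0; last first.
  by move=> k /andP[/andP[Nk _] _]; rewrite addnK F0 // Nk orbT.
rewrite big_mkord; apply: eq_big => [j|j _]; first by rewrite leq_addl.
by rewrite addnK.
Qed.
End Antidiagonals.

Section ExponentialOfDerivation.
Variables (R : realType) (V : normedModType R) (m : V -> V -> V) (D : V -> V).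
Hypotheses (mC : commutative m) (mDl : left_distributive m +%R).
Hypothesis mZl : forall r x y, m (r *: x) y = r *: m x y.
Hypothesis lD : linear D.
Hypothesis Dm : forall x y, D (m x y) = m (D x) y + m x (D y).

Let mDr z : {morph m z : x y / x + y}.
Proof. by move=> x y; rewrite mC mDl ![m _ z]mC. Qed.
Let mZr r x y : m x (r *: y) = r *: m x y.
Proof. by rewrite mC mZl mC. Qed.
Let m0l y : m 0 y = 0.
Proof. by have := mZl 0 0 y; rewrite !scale0r. Qed.
Let m0r y : m y 0 = 0.
Proof. by rewrite mC m0l. Qed.
Let msuml (I : Type) (r : seq I) (F : I -> V) y :
  m (\sum_(i <- r) F i) y = \sum_(i <- r) m (F i) y.
Proof. by apply: (big_morph (fun x => m x y)) => // u v; rewrite mDl. Qed.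
Let msumr (I : Type) (r : seq I) (F : I -> V) y :
  m y (\sum_(i <- r) F i) = \sum_(i <- r) m y (F i).
Proof. exact: (big_morph (m y) (mDr y) (m0r y)). Qed.

Section Diagonalizable.
Variables (I : finType) (l : I -> R).
Hypothesis dec : forall x, exists v : I -> V,
  x = \sum_i v i /\ forall i, D (v i) = l i *: v i.

Lemma exp_diag_linear : linear (expV D).
Proof.
move=> r x y; have [v [xE Dv]] := dec x; have [w [yE Dw]] := dec y.
have -> : r *: x + y = \sum_i (r *: v i + w i).
  by rewrite big_split /= -scaler_sumr -xE -yE.
rewrite (exp_eigen lD (l := l)); last first.
  by move=> i; rewrite lD Dv Dw scalerDr !scalerA [r * _]mulrC.
rewrite {1}xE yE !(exp_eigen lD (l := l)) // scaler_sumr -big_split /=.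
by apply: eq_bigr => i _; rewrite scalerDr !scalerA [r * _]mulrC.
Qed.

Lemma exp_diagK : cancel (expV D) (expV (fun x => - D x)).
Proof.
move=> x; have [v [xE Dv]] := dec x.
have lND : linear (fun x => - D x).
  by move=> r y z; rewrite lD opprD scalerN.
rewrite {1}xE (exp_eigen lD Dv) (exp_eigen lND (l := fun i => - l i)); last first.
  by move=> i; rewrite (linear_scaleE lD) Dv !scalerA -scaleNr; congr (_ *: _); ring.
rewrite [RHS]xE; apply: eq_bigr => i _.
by rewrite scalerA expRN mulVf ?scale1r // gt_eqF // expR_gt0.
Qed.

(** By the Leibniz rule the product of eigenvectors for l i and l j is an eigenvector for l i + l j,
    so the claim reduces to the functional equation of the real exponential. *)
Lemma exp_diag_morph x y : expV D (m x y) = m (expV D x) (expV D y).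
Proof.
have [v [xE Dv]] := dec x; have [w [yE Dw]] := dec y.
rewrite {1}xE {1}yE msuml; under eq_bigr do rewrite msumr.
rewrite (pair_bigA _ (fun i j => m (v i) (w j))) /=.
rewrite (exp_eigen lD (l := fun p => l p.1 + l p.2)); last first.
  by move=> p; rewrite Dm Dv Dw mZl mZr scalerDl.
rewrite [in RHS]xE [in RHS]yE (exp_eigen lD Dv) (exp_eigen lD Dw) msuml.
under [RHS]eq_bigr do rewrite msumr.
rewrite (pair_bigA _ (fun i j => m (_ *: v i) (_ *: w j))) /=.
by apply: eq_bigr => p _; rewrite mZl mZr scalerA expRD.
Qed.
End Diagonalizable.

Section Nilpotent.
Variable N : nat.
Hypothesis DN : forall x, iter N D x = 0.

Lemma exp_nil_linear : linear (expV D).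
Proof.
have li n : linear (iter n D).
  by elim: n => // n IH r x y; rewrite !iterS IH lD.
move=> r x y; rewrite !(exp_nilpotent lD (DN _)) scaler_sumr -big_split /=.
by apply: eq_bigr => n _; rewrite li scalerDr !scalerA mulrC.
Qed.

Let iterDN n x : (N <= n)%N -> iter n D x = 0.
Proof.
move=> Nn; rewrite -(subnK Nn) iterD DN.
by elim: (n - N)%N => // k IH; rewrite iterS IH linear_0E.
Qed.

Let term n x := (n`!%:R)^-1 *: iter n D x.

Let Dterm n x : D (term n x) = term n.+1 x *+ n.+1.
Proof.
rewrite /term (linear_scaleE lD) iterS -scaler_nat scalerA; congr (_ *: _).
by rewrite factS natrM invfM mulrA divff ?mul1r // pnatr_eq0.
Qed.

Let term0 n x : (N <= n)%N -> term n x = 0.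
Proof. by move=> Nn; rewrite /term iterDN // scaler0. Qed.

(** The iterated Leibniz rule; with the divided powers D^n / n! its binomial coefficients
    disappear. *)
Let leibniz n x y : term n (m x y) = \sum_(i < n.+1) m (term i x) (term (n - i) y).
Proof.
elim: n => [|n IH].
  by rewrite big_ord1 /term /= fact0 invr1 !scale1r.
have n0 : (n.+1%:R : R) != 0 by rewrite pnatr_eq0.
apply: (scalerI n0); rewrite !scaler_nat -Dterm IH.
rewrite (big_morph D (linear_addE lD) (linear_0E lD)) -sumrMnl.
pose G i := m (term i x) (term (n.+1 - i) y).
(* D hits either factor. After a shift of index in the first sum, G i is counted i + (n + 1 - i) = n
   + 1 times. *)
transitivity (\sum_(i < n.+1) G i.+1 *+ i.+1 + \sum_(i < n.+1) G i *+ (n.+1 - i)).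
  rewrite -big_split; apply: eq_bigr => i _ /=.
  have le_in : (i <= n)%N by rewrite -ltnS.
  rewrite Dm !Dterm /G subSS (subSn le_in).
  have mMl k u w : m (u *+ k) w = m u w *+ k by rewrite -scaler_nat mZl scaler_nat.
  have mMr k u w : m u (w *+ k) = m u w *+ k by rewrite -scaler_nat mZr scaler_nat.
  by rewrite mMl mMr.
transitivity (\sum_(i < n.+2) G i *+ i + \sum_(i < n.+2) G i *+ (n.+1 - i)).
  rewrite [X in _ = X + _]big_ord_recl mulr0n add0r [X in _ = _ + X]big_ord_recr /=.
  by rewrite subnn mulr0n addr0.
rewrite -big_split; apply: eq_bigr => i _ /=.
by rewrite -mulrnDr subnKC // -ltnS.
Qed.

Lemma exp_nil_morph x y : expV D (m x y) = m (expV D x) (expV D y).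
Proof.
rewrite (exp_nilpotent (N := N + N) lD); last by rewrite iterDN ?leq_addr.
rewrite !(exp_nilpotent lD (DN _)) msuml.
under [RHS]eq_bigr do rewrite msumr.
rewrite -(@sum_antidiagonals _ N (fun i j => m (term i x) (term j y))); last first.
  by move=> i j /orP[] h; rewrite (term0 _ h) ?m0l ?m0r.
by apply: eq_bigr => n _; exact: leibniz.
Qed.

Lemma exp_nilK : cancel (expV D) (expV (fun x => - D x)).
Proof.
move=> x.
have lND : linear (fun x => - D x).
  by move=> r y z; rewrite lD opprD scalerN.
have itN n y : iter n (fun x => - D x) y = (-1) ^+ n *: iter n D y.
  elim: n => [|n IH]; first by rewrite expr0 scale1r.
  by rewrite !iterS IH (linear_scaleE lD) exprS mulN1r scaleNr.
have itL n r (y : V) : iter n D (r *: y) = r *: iter n D y.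
  by elim: n => // n IH; rewrite !iterS IH (linear_scaleE lD).
have itS n (F : 'I_N -> V) : iter n D (\sum_i F i) = \sum_i iter n D (F i).
  elim: n => // n IH; rewrite !iterS IH.
  by rewrite (big_morph D (linear_addE lD) (linear_0E lD)).
rewrite (exp_nilpotent (N := N) lND); last by rewrite itN DN scaler0.
rewrite (exp_nilpotent lD (DN _)).
pose F i j := (-1) ^+ i *: ((i`!%:R)^-1 * (j`!%:R)^-1 *: iter (i + j) D x).
transitivity (\sum_(i < N) \sum_(j < N) F i j).
  apply: eq_bigr => i _; rewrite itN itS !scaler_sumr; apply: eq_bigr => j _.
  by rewrite itL /F iterD !scalerA; congr (_ *: _); ring.
rewrite -(@sum_antidiagonals _ N F); last first.
  move=> i j /orP[] h; rewrite /F iterDN ?scaler0 //.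
    by rewrite (leq_trans h) ?leq_addr.
  by rewrite (leq_trans h) ?leq_addl.
(* On each antidiagonal the binomial theorem produces (1 - 1)^n / n!, so only n = 0 contributes. *)
have FE n : \sum_(i < n.+1) F i (n - i)%N = ((1 - 1) ^+ n / n`!%:R) *: iter n D x.
  rewrite exprDn mulr_suml scaler_suml; apply: eq_bigr => i _.
  have le_in : (i <= n)%N by rewrite -ltnS.
  rewrite /F subnKC // scalerA; congr (_ *: _).
  have nz k : (k`!%:R : R) != 0 by rewrite pnatr_eq0 -lt0n fact_gt0.
  have C0 : ('C(n, i)%:R : R) != 0 by rewrite pnatr_eq0 -lt0n bin_gt0.
  rewrite expr1n mul1r -mulr_natr -(bin_fact le_in) !natrM.
  by field; rewrite C0 !nz.
under eq_bigr do rewrite FE.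
(* For N = 0 nilpotency says x = 0, and the sum is empty. *)
case: N DN => [DN0|k _]; first by rewrite big_ord0; exact: esym (DN0 x).
rewrite addSn big_ord_recl expr0 fact0 divr1 scale1r big1 ?addr0 // => i _.
by rewrite subrr expr0n mul0r scale0r.
Qed.
End Nilpotent.
End ExponentialOfDerivation.

(** * The derivations of the Jordan algebra *)

Lemma derivation_of_sq (R : realType) (V : lmodType R) (m : V -> V -> V) (D : V -> V) :
  commutative m -> left_distributive m +%R -> linear D ->
  (forall x, D (m x x) = 2 *: m (D x) x) ->
  forall x y, D (m x y) = m (D x) y + m x (D y).
Proof.
move=> mC mDl lD sq x y; have DD := linear_addE lD.
have mDr z : {morph m z : x y / x + y} by move=> u v; rewrite mC mDl ![m _ z]mC.
have := sq (x + y); rewrite DD !(mDl, mDr) !DD !sq !scalerDr.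
rewrite -!addrA => /addrI; rewrite !addrA => /addIr.
rewrite [m y x]mC [m (D y) x]mC => h.
have n2 : (2 : R) != 0 by rewrite pnatr_eq0.
by apply: (scalerI n2); rewrite scalerDr -h scaler_nat mulr2n.
Qed.

Section Derivations.
Variable R : realType.
Local Notation oct := (oct R).
Local Notation J1 := (J1 R).

Lemma tA1E (a : oct) (a1 a2 a3 : R) (x1 x2 x3 : oct) :
  tA1 a (h1 a1 a2 a3 x1 x2 x3) =
  h1 0 (2 * odot a x1) (- (2 * odot a x1))
     (- ((a2 - a3) *: a)) (- oconj (omul x3 a)) (oconj (omul a x2)).
Proof. by []. Qed.
Lemma tA2E (a : oct) (a1 a2 a3 : R) (x1 x2 x3 : oct) :
  tA2 a (h1 a1 a2 a3 x1 x2 x3) =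
  h1 (2 * odot a x2) 0 (- (2 * odot a x2))
     (- oconj (omul a x3)) (- ((a3 - a1) *: a)) (- oconj (omul x1 a)).
Proof. by []. Qed.
Lemma deltaJE (p : oct) (a1 a2 a3 : R) (x1 x2 x3 : oct) :
  deltaJ p (h1 a1 a2 a3 x1 x2 x3) =
  h1 0 0 0 (omul p x1) (omul x2 p) (- (omul p x3 + omul x3 p)).
Proof. by []. Qed.

Lemma tA1_linear a : linear (@tA1 R a).
Proof.
move=> r X Y.
have [a1 [a2 [a3 [x1 [x2 [x3 ->]]]]]] := J1P X.
have [b1 [b2 [b3 [y1 [y2 [y3 ->]]]]]] := J1P Y.
rewrite h1Z h1D !tA1E h1Z h1D; apply: J1_ext; generalize a x1 x2 x3 y1 y2 y3; clear.
1-3: by dot_ring.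
all: by oct_ring.
Qed.

Lemma tA2_linear a : linear (@tA2 R a).
Proof.
move=> r X Y.
have [a1 [a2 [a3 [x1 [x2 [x3 ->]]]]]] := J1P X.
have [b1 [b2 [b3 [y1 [y2 [y3 ->]]]]]] := J1P Y.
rewrite h1Z h1D !tA2E h1Z h1D; apply: J1_ext; generalize a x1 x2 x3 y1 y2 y3; clear.
1-3: by dot_ring.
all: by oct_ring.
Qed.

Lemma tA3_linear a : linear (@tA3 R a).
Proof.
move=> r X Y.
have [a1 [a2 [a3 [x1 [x2 [x3 ->]]]]]] := J1P X.
have [b1 [b2 [b3 [y1 [y2 [y3 ->]]]]]] := J1P Y.
rewrite h1Z h1D !tA3E h1Z h1D; apply: J1_ext; generalize a x1 x2 x3 y1 y2 y3; clear.
1-3: by dot_ring.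
all: by oct_ring.
Qed.

Lemma deltaJ_linear p : linear (@deltaJ R p).
Proof.
move=> r X Y.
have [a1 [a2 [a3 [x1 [x2 [x3 ->]]]]]] := J1P X.
have [b1 [b2 [b3 [y1 [y2 [y3 ->]]]]]] := J1P Y.
rewrite h1Z h1D !deltaJE h1Z h1D; apply: J1_ext; generalize p x1 x2 x3 y1 y2 y3; clear.
1-3: by dot_ring.
all: by oct_ring.
Qed.

Lemma tA1_sq (a : oct) (X : J1) : tA1 a (jordan X X) = 2 *: jordan (tA1 a X) X.
Proof.
have [a1 [a2 [a3 [x1 [x2 [x3 ->]]]]]] := J1P X.
rewrite jordan_sqE !tA1E jordanE h1Z; apply: J1_ext; generalize a x1 x2 x3; clear.
1-3: by dot_ring.
all: by oct_field.
Qed.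
Lemma tA2_sq (a : oct) (X : J1) : tA2 a (jordan X X) = 2 *: jordan (tA2 a X) X.
Proof.
have [a1 [a2 [a3 [x1 [x2 [x3 ->]]]]]] := J1P X.
rewrite jordan_sqE !tA2E jordanE h1Z; apply: J1_ext; generalize a x1 x2 x3; clear.
1-3: by dot_ring.
all: by oct_field.
Qed.
Lemma tA3_sq (a : oct) (X : J1) : tA3 a (jordan X X) = 2 *: jordan (tA3 a X) X.
Proof.
have [a1 [a2 [a3 [x1 [x2 [x3 ->]]]]]] := J1P X.
rewrite jordan_sqE !tA3E jordanE h1Z; apply: J1_ext; generalize a x1 x2 x3; clear.
1-3: by dot_ring.
all: by oct_field.
Qed.

Lemma deltaJ_sq (p : oct) (X : J1) : oIm p -> deltaJ p (jordan X X) = 2 *: jordan (deltaJ p X) X.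
Proof.
have [a1 [a2 [a3 [x1 [x2 [x3 ->]]]]]] := J1P X.
rewrite jordan_sqE !deltaJE jordanE h1Z.
case: p => [[[p0 p1] [p2 p3]] [[p4 p5] [p6 p7]]]; rewrite /oIm /oRe /= => ->.
apply: J1_ext; generalize x1 x2 x3; clear.
1-3: by dot_ring.
all: by oct_field.
Qed.

End Derivations.

Section SumsOfDerivations.
Variables (R : realType) (V : lmodType R) (m : V -> V -> V).
Hypotheses (mC : commutative m) (mDl : left_distributive m +%R).
Hypothesis mZl : forall r x y, m (r *: x) y = r *: m x y.

Definition derivation (D : V -> V) :=
  linear D /\ forall x y, D (m x y) = m (D x) y + m x (D y).

Let mDr z : {morph m z : x y / x + y}.
Proof. by move=> u v; rewrite mC mDl ![m _ z]mC. Qed.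

Lemma derivationD D1 D2 : derivation D1 -> derivation D2 ->
  derivation (fun x => D1 x + D2 x).
Proof.
move=> [l1 d1] [l2 d2]; split=> [r x y|x y]; first by rewrite l1 l2 scalerDr addrACA.
by rewrite d1 d2 mDl mDr addrACA.
Qed.

Lemma derivationZ r D : derivation D -> derivation (fun x => r *: D x).
Proof.
move=> [lD dD]; split=> [s x y|x y].
  by rewrite lD scalerDr !scalerA mulrC.
by rewrite dD scalerDr mZl ![m x _]mC mZl.
Qed.

Lemma derivationN D : derivation D -> derivation (fun x => - D x).
Proof.
move=> /(derivationZ (-1)); suff -> : (fun x => -1 *: D x) = (fun x => - D x) by [].
by apply/funext => x; rewrite scaleN1r.
Qed.
End SumsOfDerivations.

Lemma sum_ord5 (V : zmodType) (F : nat -> V) :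
  \sum_(i < 5) F i = F 0 + (F 1 + (F 2 + (F 3 + F 4))).
Proof. by rewrite !big_ord_recl big_ord0 addr0. Qed.

Section Subgroups.
Variable R : realType.
Local Notation oct := (oct R).
Local Notation J1 := (J1 R).
Local Notation P := (@Pminus R).
Local Notation Q := (sigmaJ (@Pminus R)).
Local Notation derivJ := (derivation (@jordan R)).

Lemma derivJ_of_sq (D : J1 -> J1) : linear D ->
  (forall X, D (jordan X X) = 2 *: jordan (D X) X) -> derivJ D.
Proof.
move=> lD sD; split; first exact: lD.
exact: (derivation_of_sq (@jordanC R) (@jordanDl R) lD sD).
Qed.

Lemma tA1_deriv (a : oct) : derivJ (tA1 a).
Proof. exact: derivJ_of_sq (tA1_linear a) (tA1_sq a). Qed.
Lemma tA2_deriv (a : oct) : derivJ (tA2 a).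
Proof. exact: derivJ_of_sq (tA2_linear a) (tA2_sq a). Qed.
Lemma tA3_deriv (a : oct) : derivJ (tA3 a).
Proof. exact: derivJ_of_sq (tA3_linear a) (tA3_sq a). Qed.
Lemma deltaJ_deriv (p : oct) : oIm p -> derivJ (deltaJ p).
Proof. by move=> pI; apply: derivJ_of_sq (deltaJ_linear p) _ => X; exact: deltaJ_sq. Qed.

Lemma expLE (D : J1 -> J1) : expL D = expV (D : J1 -> J1).
Proof. rewrite /expL /expV; reflexivity. Qed.

(** The component of X in the eigenspace of tA3 1 for the eigenvalue 2 - i; parts 0 and 4 are
    multiples of P^- and Q. *)
Definition tA3_part (X : J1) (i : nat) : J1 :=
  let: (a1, a2, a3, x1, x2, x3) := X in
  match i with
  | 0 => h1 (- (oRe x3 / 2 - (a1 - a2) / 4)) (oRe x3 / 2 - (a1 - a2) / 4) 0 0 0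
            ((oRe x3 / 2 - (a1 - a2) / 4) *: oone R)
  | 1 => h1 0 0 0 (2^-1 *: (x1 + oconj x2)) (2^-1 *: (oconj x1 + x2)) 0
  | 2 => h1 ((a1 + a2) / 2) ((a1 + a2) / 2) a3 0 0 (x3 - oRe x3 *: oone R)
  | 3 => h1 0 0 0 (2^-1 *: (x1 - oconj x2)) (- (2^-1 *: (oconj x1 - x2))) 0
  | _ => h1 (oRe x3 / 2 + (a1 - a2) / 4) (- (oRe x3 / 2 + (a1 - a2) / 4)) 0 0 0
            ((oRe x3 / 2 + (a1 - a2) / 4) *: oone R)
  end.

Lemma tA3_part_add (a1 a2 a3 : R) (x1 x2 x3 : oct) (X := h1 a1 a2 a3 x1 x2 x3) :
  tA3_part X 0 + (tA3_part X 1 + (tA3_part X 2 + (tA3_part X 3 + tA3_part X 4))) = X.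
Proof.
rewrite {}/X; rewrite -[tA3_part _ 0]/(h1 _ _ _ _ _ _) -[tA3_part _ 1]/(h1 _ _ _ _ _ _).
rewrite -[tA3_part _ 2]/(h1 _ _ _ _ _ _) -[tA3_part _ 3]/(h1 _ _ _ _ _ _).
rewrite -[tA3_part _ 4]/(h1 _ _ _ _ _ _).
rewrite !h1D.
by apply: J1_ext; generalize a1 a2 a3 x1 x2 x3; clear; rewrite /oRe;
  first [by oct_field|by oct_coord; oct_simpl; field].
Qed.

Lemma tA3_part_sum X : X = \sum_(i < 5) tA3_part X i.
Proof.
have [a1 [a2 [a3 [x1 [x2 [x3 ->]]]]]] := J1P X.
apply/esym; apply: etrans (sum_ord5 (tA3_part _)) _; exact: tA3_part_add.
Qed.

Lemma tA3_part_eigen X (i : 'I_5) :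
  tA3 (oone R) (tA3_part X i) = (2 - (i : nat)%:R) *: tA3_part X i.
Proof.
have [a1 [a2 [a3 [x1 [x2 [x3 ->]]]]]] := J1P X.
case: i => -[|[|[|[|[|//]]]]] i; rewrite [nat_of_ord _]/= -[tA3_part _ _]/(h1 _ _ _ _ _ _) tA3E h1Z;
  (apply: J1_ext; generalize a1 a2 a3 x1 x2 x3; clear; rewrite /oRe);
  first [by oct_field|by oct_coord; oct_simpl; field].
Qed.

End Subgroups.

Section ExponentialBijective.
Variables (R : realType) (V : normedModType R) (D : V -> V).
Hypothesis lD : linear D.

Let lND : linear (fun x => - D x).
Proof. by move=> r x y; rewrite lD opprD scalerN. Qed.
Let DNN : (fun x => - - D x) = D.
Proof. by apply/funext => x; rewrite opprK. Qed.

Lemma exp_diag_bij (I : finType) (l : I -> R) :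
  (forall x, exists v : I -> V, x = \sum_i v i /\ forall i, D (v i) = l i *: v i) ->
  bijective (expV D).
Proof.
move=> dec; exists (expV (fun x => - D x)); first exact: (exp_diagK lD dec).
rewrite -[X in cancel _ (expV X)]DNN; apply: (exp_diagK lND (l := fun i => - l i)).
move=> x; have [v [xE Dv]] := dec x; exists v; split=> // i.
by rewrite Dv scaleNr.
Qed.

Lemma exp_nil_bij N : (forall x, iter N D x = 0) -> bijective (expV D).
Proof.
move=> DN; exists (expV (fun x => - D x)); first exact: (exp_nilK lD DN).
rewrite -[X in cancel _ (expV X)]DNN; apply: (exp_nilK lND (N := N)) => x.
have -> : iter N (fun x => - D x) x = (-1) ^+ N *: iter N D x.
  elim: N {DN} => [|n IH]; first by rewrite expr0 scale1r.
  by rewrite !iterS IH (linear_scaleE lD) exprS mulN1r scaleNr.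
by rewrite DN scaler0.
Qed.

Lemma exp_eigenvector l v : D v = l *: v -> expV D v = expR l *: v.
Proof.
move=> Dv; have := exp_eigen (I := 'I_1) (l := fun=> l) (v := fun=> v) lD (fun=> Dv).
by rewrite !big_ord1.
Qed.

End ExponentialBijective.

Section ExponentialsInF4.
Variable R : realType.
Local Notation oct := (oct R).
Local Notation J1 := (J1 R).
Local Notation P := (@Pminus R).
Local Notation Q := (sigmaJ (@Pminus R)).
Local Notation derivJ := (derivation (@jordan R)).

Lemma tA3_scaled_deriv (t : R) : derivJ (fun X => t *: tA3 (oone R) X).
Proof. exact: (derivationZ (@jordanC R) (@jordanZl R) t (tA3_deriv (oone R))). Qed.

Lemma exp_tA3_F4 (t : R) : F4 R (expL (fun X => t *: tA3 (oone R) X)).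
Proof.
rewrite expLE; have [lD dD] := tA3_scaled_deriv t.
have dec X : exists v : 'I_5 -> J1, X = \sum_i v i /\
    forall i, t *: tA3 (oone R) (v i) = (t * (2 - (i : nat)%:R)) *: v i.
  exists (fun i => tA3_part X i); split; first exact: tA3_part_sum.
  by move=> i; rewrite tA3_part_eigen scalerA.
split.
- exact: (exp_diag_linear lD dec).
- exact: (exp_diag_bij lD dec).
- exact: (exp_diag_morph (@jordanC R) (@jordanDl R) (@jordanZl R) lD dD dec).
Qed.

Lemma tA3_Pminus : tA3 (oone R) P = 2 *: P.
Proof.
rewrite /Pminus tA3E h1Z; apply: J1_ext; clear.
1-3: by oct_coord; oct_simpl; ring.
all: by oct_ring.
Qed.

Lemma tA3_Q : tA3 (oone R) Q = - 2 *: Q.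
Proof.
rewrite QE tA3E h1Z; apply: J1_ext; clear.
1-3: by oct_coord; oct_simpl; ring.
all: by oct_ring.
Qed.

Lemma exp_tA3_Pminus (t : R) :
  expL (fun X => t *: tA3 (oone R) X) P = expR (2 * t) *: P.
Proof.
rewrite expLE; have [lD _] := tA3_scaled_deriv t.
by apply: (exp_eigenvector lD); rewrite tA3_Pminus scalerA mulrC.
Qed.

Lemma exp_tA3_Q (t : R) :
  expL (fun X => t *: tA3 (oone R) X) Q = expR (- (2 * t)) *: Q.
Proof.
rewrite expLE; have [lD _] := tA3_scaled_deriv t.
by apply: (exp_eigenvector lD); rewrite tA3_Q scalerA mulrN mulrC.
Qed.

(** * The Lie algebra of N^+ and its triangular form in the grading *)

Definition Nalg (x p : oct) (X : J1) : J1 := G1 x X + G2 p X.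

Lemma Nalg_deriv (x p : oct) : oIm p -> derivJ (Nalg x p).
Proof.
move=> pI.
have D1 := derivationD (@jordanC R) (@jordanDl R) (tA1_deriv x) (tA2_deriv (- oconj x)).
have D2 := derivationN (@jordanC R) (@jordanZl R) (deltaJ_deriv pI).
have D3 := derivationD (@jordanC R) (@jordanDl R) (tA3_deriv (- p)) D2.
exact: (derivationD (@jordanC R) (@jordanDl R) D1 D3).
Qed.

(* formP, coW, (coI, co3, trJ), coV, formQ are coordinates dual to the eigenspaces of tA3 1 for
   the eigenvalues -2, -1, 0, 1, 2, and [Nalg x p] is strictly triangular in them. *)
Definition coW (X : J1) : oct := let: (_, _, _, x1, x2, _) := X in x1 - oconj x2.
Definition coV (X : J1) : oct := let: (_, _, _, x1, x2, _) := X in x1 + oconj x2.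
Definition coI (X : J1) : oct := let: (_, _, _, _, _, x3) := X in x3 - oconj x3.
Definition co3 (X : J1) : R := let: (_, _, a3, _, _, _) := X in a3.
Definition formQ (X : J1) : R := let: (a1, a2, _, _, _, x3) := X in - a1 + a2 + 2 * oRe x3.

Lemma coWE (a1 a2 a3 : R) (x1 x2 x3 : oct) : coW (h1 a1 a2 a3 x1 x2 x3) = x1 - oconj x2.
Proof. by []. Qed.
Lemma coVE (a1 a2 a3 : R) (x1 x2 x3 : oct) : coV (h1 a1 a2 a3 x1 x2 x3) = x1 + oconj x2.
Proof. by []. Qed.
Lemma coIE (a1 a2 a3 : R) (x1 x2 x3 : oct) : coI (h1 a1 a2 a3 x1 x2 x3) = x3 - oconj x3.
Proof. by []. Qed.
Lemma co3E (a1 a2 a3 : R) (x1 x2 x3 : oct) : co3 (h1 a1 a2 a3 x1 x2 x3) = a3.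
Proof. by []. Qed.
Lemma trJE (a1 a2 a3 : R) (x1 x2 x3 : oct) : trJ (h1 a1 a2 a3 x1 x2 x3) = a1 + a2 + a3.
Proof. by []. Qed.
Lemma formQE (a1 a2 a3 : R) (x1 x2 x3 : oct) :
  formQ (h1 a1 a2 a3 x1 x2 x3) = - a1 + a2 + 2 * oRe x3.
Proof. by []. Qed.

(** These coordinates jointly determine X, so nilpotency can be checked on them one at a time. *)
Lemma grading_eq0 X : formP X = 0 -> coW X = 0 -> coI X = 0 -> co3 X = 0 ->
  trJ X = 0 -> coV X = 0 -> formQ X = 0 -> X = 0.
Proof.
have [a1 [a2 [a3 [x1 [x2 [x3 ->]]]]]] := J1P X.
rewrite formPE coWE coIE co3E trJE coVE formQE h10.
move=> eP eW eI e3 et eV eQ.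
have x1E : x1 = 2^-1 *: ((x1 - oconj x2) + (x1 + oconj x2)).
  by generalize x1 x2; clear; oct_field.
have x2E : x2 = oconj (2^-1 *: ((x1 + oconj x2) - (x1 - oconj x2))).
  by generalize x1 x2; clear; oct_field.
have x3E : x3 = 2^-1 *: (x3 - oconj x3) + oRe x3 *: oone R.
  by generalize x3; clear; rewrite /oRe; oct_field.
have [r0 [z1 z2]] : oRe x3 = 0 /\ a1 = 0 /\ a2 = 0.
  by move: eP eQ et e3; generalize (oRe x3); clear => r; lra.
rewrite eV eW in x1E x2E; rewrite eI r0 in x3E.
rewrite z1 z2 e3 x1E x2E x3E; apply: J1_ext => //; clear; oct_ring.
Qed.

Lemma oImP (p : oct) : oIm p -> exists p1 p2 p3 p4 p5 p6 p7,
  p = (((0, p1), (p2, p3)), ((p4, p5), (p6, p7))).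
Proof.
case: p => [[[p0 p1] [p2 p3]] [[p4 p5] [p6 p7]]]; rewrite /oIm /oRe /= => ->.
by exists p1, p2, p3, p4, p5, p6, p7.
Qed.

Lemma NalgE (x p : oct) (a1 a2 a3 : R) (x1 x2 x3 : oct) :
  Nalg x p (h1 a1 a2 a3 x1 x2 x3) =
  h1 (- 2 * odot (oconj x) x2 + 2 * odot p x3) (2 * odot x x1 - 2 * odot p x3)
     (- 2 * odot x x1 + 2 * odot (oconj x) x2)
     ((a3 - a2) *: x + oconj (omul (oconj x) x3) - oconj (omul x2 p) - omul p x1)
     ((a3 - a1) *: oconj x - oconj (omul x3 x) - oconj (omul p x1) - omul x2 p)
     (oconj (omul x x2) + oconj (omul x1 (oconj x)) + (a1 - a2) *: p
      + (omul p x3 + omul x3 p)).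
Proof.
rewrite /Nalg /G1 /G2 tA1E tA2E tA3E deltaJE h1N !h1D.
apply: J1_ext; generalize x p x1 x2 x3; clear.
1-3: by dot_ring.
all: by oct_ring.
Qed.

Lemma formP_Nalg (x p : oct) X : oIm p -> formP (Nalg x p X) = 0.
Proof.
have [a1 [a2 [a3 [x1 [x2 [x3 ->]]]]]] := J1P X; rewrite NalgE formPE.
case/oImP=> [p1 [p2 [p3 [p4 [p5 [p6 [p7 pE]]]]]]].
by rewrite ?pE; generalize x x1 x2 x3; clear; rewrite /oRe; dot_ring.
Qed.

Lemma trJ_Nalg (x p : oct) X : oIm p -> trJ (Nalg x p X) = 0.
Proof.
have [a1 [a2 [a3 [x1 [x2 [x3 ->]]]]]] := J1P X; rewrite NalgE trJE.
case/oImP=> [p1 [p2 [p3 [p4 [p5 [p6 [p7 pE]]]]]]].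
by rewrite ?pE; generalize x x1 x2 x3; clear; rewrite /oRe; dot_ring.
Qed.

Lemma coW_Nalg (x p : oct) X : oIm p -> coW (Nalg x p X) = - formP X *: x.
Proof.
have [a1 [a2 [a3 [x1 [x2 [x3 ->]]]]]] := J1P X; rewrite NalgE !coWE formPE /oRe.
case/oImP=> [p1 [p2 [p3 [p4 [p5 [p6 [p7 pE]]]]]]].
by rewrite ?pE; generalize x x1 x2 x3; clear; rewrite /oRe; oct_ring.
Qed.

Lemma co3_Nalg (x p : oct) X : oIm p -> co3 (Nalg x p X) = - 2 * odot x (coW X).
Proof.
have [a1 [a2 [a3 [x1 [x2 [x3 ->]]]]]] := J1P X; rewrite NalgE co3E coWE.
case/oImP=> [p1 [p2 [p3 [p4 [p5 [p6 [p7 pE]]]]]]].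
by rewrite ?pE; generalize x x1 x2 x3; clear; rewrite /oRe; dot_ring.
Qed.

Lemma coI_Nalg (x p : oct) X : oIm p -> coI (Nalg x p X) =
  omul x (oconj (coW X)) - omul (coW X) (oconj x) - (2 * formP X) *: p.
Proof.
have [a1 [a2 [a3 [x1 [x2 [x3 ->]]]]]] := J1P X; rewrite NalgE !coIE coWE formPE /oRe.
case/oImP=> [p1 [p2 [p3 [p4 [p5 [p6 [p7 pE]]]]]]].
by rewrite ?pE; generalize x x1 x2 x3; clear; rewrite /oRe; oct_ring.
Qed.

Lemma coV_Nalg (x p : oct) X : oIm p -> coV (Nalg x p X) =
  (3 * co3 X - trJ X) *: x - omul (coI X) x - 2 *: omul p (coW X).
Proof.
have [a1 [a2 [a3 [x1 [x2 [x3 ->]]]]]] := J1P X; rewrite NalgE coVE co3E trJE coIE coWE.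
case/oImP=> [p1 [p2 [p3 [p4 [p5 [p6 [p7 pE]]]]]]].
by rewrite ?pE; generalize x x1 x2 x3; clear; rewrite /oRe; oct_ring.
Qed.

Lemma formQ_Nalg (x p : oct) X : oIm p ->
  formQ (Nalg x p X) = 4 * odot x (coV X) - 4 * odot p (coI X).
Proof.
have [a1 [a2 [a3 [x1 [x2 [x3 ->]]]]]] := J1P X; rewrite NalgE formQE coVE coIE.
case/oImP=> [p1 [p2 [p3 [p4 [p5 [p6 [p7 pE]]]]]]].
by rewrite ?pE; generalize x x1 x2 x3; clear; rewrite /oRe; dot_ring.
Qed.

End ExponentialsInF4.

(** * The action of MAN on the null cone *)

Section ScaledFixedVectors.
Variables (R : realType) (V : lmodType R) (g n a g' n' a' : V -> V) (r : R).
Hypotheses (lg : linear g) (ln : linear n) (la : linear a).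

Lemma inverse_scale s t p : cancel g g' -> s * t = 1 -> g p = t *: p -> g' p = s *: p.
Proof.
move=> gK st gp; rewrite -[RHS]gK (linear_scaleE lg) gp scalerA st scale1r.
by [].
Qed.

Hypotheses (nK : cancel n n') (aK : cancel a a') (r0 : r != 0).

(** With [corrected_fix_opposite], this shows that the candidate m = g n^-1 a^-1 for the M-component
    of g fixes P^- and Q. *)
Lemma corrected_fix p : g p = r *: p -> n p = p -> a p = r *: p -> g (n' (a' p)) = p.
Proof.
move=> gp np ap.
have -> : a' p = r^-1 *: p.
  by rewrite -[RHS]aK (linear_scaleE la) ap scalerA mulVf // scale1r.
have -> : n' (r^-1 *: p) = r^-1 *: p by rewrite -[RHS]nK (linear_scaleE ln) np.
by rewrite (linear_scaleE lg) gp scalerA mulVf // scale1r.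
Qed.

Lemma corrected_fix_opposite q : cancel g' g ->
  n (r^-1 *: g' q) = q -> a q = r^-1 *: q -> g (n' (a' q)) = q.
Proof.
move=> g'K nq aq.
have -> : a' q = r *: q.
  by rewrite -[RHS]aK (linear_scaleE la) aq scalerA mulfV // scale1r.
rewrite -{1}nq -(linear_scaleE ln) nK scalerA mulfV // scale1r; exact: g'K.
Qed.
End ScaledFixedVectors.

Section NilpotentExponential.
Variables (R : realType) (V : normedModType R) (W : lmodType R).
Lemma exp_nil_comp N (D : V -> V) (phi : V -> W) x : linear D -> linear phi ->
  iter N D x = 0 ->
  phi (expV D x) = \sum_(n < N) (n`!%:R)^-1 *: phi (iter n D x).
Proof.
move=> lD lphi DN; rewrite (exp_nilpotent lD DN).
rewrite (big_morph phi (linear_addE lphi) (linear_0E lphi)).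
by apply: eq_bigr => i _; rewrite (linear_scaleE lphi).
Qed.
End NilpotentExponential.

Section HorosphericalAction.
Variable R : realType.
Local Notation oct := (oct R).
Local Notation J1 := (J1 R).
Local Notation P := (@Pminus R).
Local Notation Q := (sigmaJ (@Pminus R)).

Lemma odot0r (x : oct) : odot x 0 = 0.
Proof. by dot_ring. Qed.
Lemma oconj0 : oconj 0 = 0 :> oct.
Proof. by oct_ring. Qed.

Section Chain.
Variables (x p : oct) (X : J1).
Hypothesis pI : oIm p.
Local Notation D := (Nalg x p).

Let f1 Y : formP (D Y) = 0. Proof. exact: formP_Nalg. Qed.
Let t1 Y : trJ (D Y) = 0. Proof. exact: trJ_Nalg. Qed.

Lemma coW_Nalg2 Y : coW (D (D Y)) = 0.
Proof. by rewrite coW_Nalg // f1 oppr0 scale0r. Qed.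
Lemma coI_Nalg3 Y : coI (D (D (D Y))) = 0.
Proof.
by rewrite coI_Nalg // coW_Nalg2 f1 oconj0 omulx0 omul0x subrr mulr0 scale0r subr0.
Qed.
Lemma co3_Nalg3 Y : co3 (D (D (D Y))) = 0.
Proof. by rewrite co3_Nalg // coW_Nalg2 odot0r mulr0. Qed.
Lemma coV_Nalg4 Y : coV (D (D (D (D Y)))) = 0.
Proof.
rewrite coV_Nalg // co3_Nalg3 t1 coI_Nalg3 coW_Nalg2.
by rewrite mulr0 subr0 scale0r omul0x omulx0 scaler0 !subr0.
Qed.
Lemma formQ_Nalg5 Y : formQ (D (D (D (D (D Y))))) = 0.
Proof. by rewrite formQ_Nalg // coV_Nalg4 coI_Nalg3 !odot0r !mulr0 subrr. Qed.

(** Each application of D annihilates the coordinates of one more degree, and the grading has five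
    degrees. *)
Lemma Nalg_nilpotent : iter 5 D X = 0.
Proof.
rewrite !iterS [iter 0 _ _]/=.
exact: grading_eq0 (f1 _) (coW_Nalg2 _) (coI_Nalg3 _) (co3_Nalg3 _) (t1 _)
  (coV_Nalg4 _) (formQ_Nalg5 _).
Qed.
End Chain.

Lemma expNalg_F4 (x p : oct) : oIm p -> F4 R (expL (Nalg x p)).
Proof.
move=> pI; rewrite expLE; have [lD dD] := Nalg_deriv x pI.
have DN X := Nalg_nilpotent x X pI.
split.
- exact: (exp_nil_linear lD DN).
- exact: (exp_nil_bij lD DN).
- exact: (exp_nil_morph (@jordanC R) (@jordanDl R) (@jordanZl R) lD dD DN).
Qed.

Lemma Nalg_Pminus (x p : oct) : oIm p -> Nalg x p P = 0.
Proof.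
move=> /oImP[p1 [p2 [p3 [p4 [p5 [p6 [p7 ->]]]]]]]; rewrite /Pminus NalgE h10.
apply: J1_ext; generalize x; clear.
1-3: by dot_ring.
all: by oct_ring.
Qed.

Lemma expNalg_Pminus (x p : oct) : oIm p -> expL (Nalg x p) P = P.
Proof.
move=> pI; rewrite expLE; have [lD _] := Nalg_deriv x pI.
have := exp_eigenvector lD (l := 0) (v := P).
by rewrite scale0r expR0 scale1r => -> //; exact: Nalg_Pminus.
Qed.

Lemma coW_linear : linear (@coW R).
Proof.
move=> r X Y.
have [a1 [a2 [a3 [x1 [x2 [x3 ->]]]]]] := J1P X.
have [b1 [b2 [b3 [y1 [y2 [y3 ->]]]]]] := J1P Y.
by rewrite h1Z h1D !coWE; generalize x1 x2 y1 y2; clear; oct_ring.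
Qed.

Lemma coI_linear : linear (@coI R).
Proof.
move=> r X Y.
have [a1 [a2 [a3 [x1 [x2 [x3 ->]]]]]] := J1P X.
have [b1 [b2 [b3 [y1 [y2 [y3 ->]]]]]] := J1P Y.
by rewrite h1Z h1D !coIE; generalize x3 y3; clear; oct_ring.
Qed.

Lemma nullcone_Q : nullcone R Q.
Proof.
rewrite QE; apply/nullconeE; split; last by rewrite oppr_lt0 ltr01.
rewrite jordan_sqE h10; apply: J1_ext; clear.
1-3: by oct_coord; oct_simpl; ring.
all: by oct_ring.
Qed.

Lemma formP_Q : formP Q = 4.
Proof. by rewrite QE formPE /oRe; oct_simpl; ring. Qed.

(** Here x1 = conj(x2) and x3 is a real s, so the null equations give |x2|^2 as a2 a3, as -a3 a1 and
    as a3 s. Together they yield a3 (a2 - a1 - 2 s) = 0, whose second factor is [formP X] = 4; hence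
    a3 = 0 and x2 = 0, and |x3|^2 = -a1 a2 fixes a1. *)
Lemma nullcone_eq_Q X : nullcone R X -> formP X = 4 -> coW X = 0 -> coI X = 0 -> X = Q.
Proof.
have [a1 [a2 [a3 [x1 [x2 [x3 ->]]]]]] := J1P X => nX.
have [[a10 t d1 d2 d3] [_ _ e3]] := nullcone_eqs nX.
rewrite formPE coWE coIE => f w i.
have x1E : x1 = oconj x2.
  by apply/eqP; rewrite -subr_eq0 w.
have x3E : x3 = oRe x3 *: oone R.
  have -> : oRe x3 *: oone R = x3 - 2^-1 *: (x3 - oconj x3).
    by generalize x3; clear; rewrite /oRe; oct_field.
  by rewrite i scaler0 subr0.
have d12 : odot x1 x1 = odot x2 x2 by rewrite x1E odot_conj.
have r3 : odot x2 x2 = a3 * oRe x3.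
  have := congr1 (fun y => odot (oone R) y) e3; rewrite /= x1E odotZr => e.
  transitivity (odot (oone R) (oconj (omul (oconj x2) x2))).
    by generalize x2; clear; dot_ring.
  by rewrite -e; congr (_ * _); generalize x3; clear; rewrite /oRe; dot_ring.
have s3 : odot x3 x3 = oRe x3 ^+ 2.
  by rewrite [in LHS]x3E odotZl odotZr odot_one mulr1.
rewrite d12 in d1; move: x3E r3 f s3; move: (oRe x3) => s x3E r3 f s3.
have a30 : a3 = 0.
  have h : a3 * (a2 - a1 - 2 * s) = 0.
    by rewrite -[RHS](subrr (odot x2 x2)); move: d1 d2 r3; clear; lra.
  move/eqP: h; rewrite mulf_eq0 => /orP[/eqP //|/eqP h].
  by move: f h; clear; lra.
have x20 : x2 = 0 by apply: odot_eq0; rewrite d2 a30 mul0r oppr0.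
have a2E : a2 = - a1 by move: t; rewrite a30; clear; lra.
have sE : s = - a1 - 2 by move: f; rewrite a2E; clear; lra.
have a1E : a1 = -1.
  by move: d3; rewrite s3 sE a2E !expr2; clear; lra.
rewrite QE; apply: J1_ext.
- exact: a1E.
- by rewrite a2E a1E opprK.
- exact: a30.
- by rewrite x1E x20 oconj0.
- exact: x20.
- by rewrite x3E sE a1E; clear; oct_ring.
Qed.

Lemma sum_first2 (V : lmodType R) (F : nat -> V) :
  (forall n, (2 <= n)%N -> F n = 0) ->
  \sum_(n < 5) (n`!%:R : R)^-1 *: F n = F 0 + F 1.
Proof.
move=> F0; rewrite !big_ord_recl big_ord0 /= fact0 invr1 !scale1r.
by rewrite (F0 2) // (F0 3) // (F0 4) // !scaler0 !addr0.
Qed.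

(** Because [formP] is constant along N^+, exp changes [coW] by -4 x. Once [coW X] = 4 x, the
    quadratic terms in the change of [coI] cancel and -8 p is left; this dictates the factors 1/4
    and 1/8. *)
Lemma Nplus_transitive X : nullcone R X -> formP X = 4 ->
  exists x p, oIm p /\ expL (Nalg x p) X = Q.
Proof.
move=> nX fX; pose x := 4^-1 *: coW X; pose p := 8^-1 *: coI X.
have wE : coW X = 4 *: x by rewrite /x scalerA divff ?scale1r // pnatr_eq0.
have iE : coI X = 8 *: p by rewrite /p scalerA divff ?scale1r // pnatr_eq0.
have pI : oIm p.
  rewrite /p; have [a1 [a2 [a3 [x1 [x2 [x3 ->]]]]]] := J1P X.
  by rewrite coIE /oIm /oRe /=; generalize x3; clear; dot_ring.
exists x, p; split=> //; have [lD _] := Nalg_deriv x pI.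
have F := expNalg_F4 x pI; have DN := Nalg_nilpotent x X pI.
have fE : formP (expL (Nalg x p) X) = 4.
  rewrite (F4_formP (r := 1) _ F); first by rewrite fX divr1.
    exact: oner_neq0.
  by rewrite scale1r expNalg_Pminus.
apply: nullcone_eq_Q fE _ _; first exact: F4_nullcone.
- rewrite expLE (exp_nil_comp lD coW_linear DN)
    (sum_first2 (F := fun n => coW (iter n (Nalg x p) X))).
    by rewrite /= coW_Nalg // fX wE; generalize x; clear; oct_ring.
  by case=> [|[|n]] // _; rewrite !iterS coW_Nalg2.
- rewrite expLE (exp_nil_comp lD coI_linear DN)
    (sum_first2 (F := fun n => coI (iter n (Nalg x p) X))).
    by rewrite /= coI_Nalg // fX wE iE; generalize x p; clear; oct_ring.
  case=> [|[|[|n]]] // _; rewrite !iterS; last by rewrite coI_Nalg3.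
  rewrite /= coI_Nalg // coW_Nalg // formP_Nalg // fX.
  by generalize x p; clear; oct_ring.
Qed.

Lemma stab_MANplus (g : J1 -> J1) r : F4 R g -> 0 < r -> g P = r *: P -> MANplus R g.
Proof.
move=> Fg r0 gP; have [lg bg _] := Fg; have [g' [gK g'K]] := bij_inv bg.
have Fg' := F4_inv Fg gK g'K; have rn0 := lt0r_neq0 r0.
have g'P := inverse_scale lg gK (mulVf rn0) gP.
(* The inverse of g multiplies [formP] by r; the factor r^-1 restores the value 4 taken at Q. *)
have nY : nullcone R (r^-1 *: g' Q).
  by apply: nullconeZ; [rewrite invr_gt0|exact: F4_nullcone nullcone_Q].
have fY : formP (r^-1 *: g' Q) = 4.
  rewrite formPZ (F4_formP Q Fg' _ g'P); last by rewrite invr_eq0.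
  by rewrite formP_Q invrK; field.
have [x [p [pI nYQ]]] := Nplus_transitive nY fY.
(* exp(t tA3 1) scales P^- by e^{2t}, which has to equal r. *)
pose t := ln r / 2.
have tE : expR (2 * t) = r by rewrite /t mulrC divfK ?pnatr_eq0 // lnK.
have Fa := exp_tA3_F4 t; have aP := exp_tA3_Pminus t; have aQ := exp_tA3_Q t.
rewrite tE in aP; rewrite expRN tE in aQ.
have Fn := expNalg_F4 x pI; have nP := expNalg_Pminus x pI.
have [la ba _] := Fa; have [ln' bn _] := Fn.
have [a' [aK a'K]] := bij_inv ba; have [n' [nK n'K]] := bij_inv bn.
have Fh := F4_comp Fg (F4_comp (F4_inv Fn nK n'K) (F4_inv Fa aK a'K)).
exists (g \o (n' \o a')), (expL (fun X => t *: tA3 (oone R) X)), (expL (Nalg x p)); split.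
- apply: F4_fix_Msub Fh _ _.
  + exact: (corrected_fix lg ln' la nK aK rn0 gP nP aP).
  + exact: (corrected_fix_opposite ln' la nK aK rn0 g'K nYQ aQ).
- by exists t.
- by exists x, p; split; [exact: pI|reflexivity].
- by apply/funext => X; exact: esym (congr1 g (etrans (congr1 n' (aK _)) (nK X))).
Qed.

Lemma MANplus_F4 (g : J1 -> J1) : MANplus R g ->
  F4 R g /\ exists2 r, 0 < r & g P = r *: P.
Proof.
move=> [m [a [n [Mm [t ->] [x [p [pI ->]]] ->]]]].
have [[Fm _] _] := Mm; have Fa := exp_tA3_F4 t; have Fn := expNalg_F4 x pI.
split; first exact: F4_comp (F4_comp Fm Fa) Fn.
exists (expR (2 * t)); first exact: expR_gt0.
rewrite -[LHS]/(m (expL _ (expL (Nalg x p) P))) expNalg_Pminus // exp_tA3_Pminus.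
by rewrite (F4Z _ _ Fm) Msub_Pminus.
Qed.
End HorosphericalAction.

(** * Continuity of the sections *)

Section CayleyDicksonContinuity.
Variables (R : realType) (V : normedModType R) (mul : V -> V -> V) (conj : V -> V).

Definition cvg_closed1 (W : topologicalType) (f : W -> W) :=
  forall (T : Type) (F : set_system T), Filter F -> forall (x : T -> W) a,
    x @ F --> a -> f (x t) @[t --> F] --> f a.

Definition cvg_closed2 (W : topologicalType) (m : W -> W -> W) :=
  forall (T : Type) (F : set_system T), Filter F -> forall (x y : T -> W) a b,
    x @ F --> a -> y @ F --> b -> m (x t) (y t) @[t --> F] --> m a b.

Lemma cvg_pair1 (U W : topologicalType) (T : Type) (F : set_system T) (f : T -> U * W) (a : U * W) :
  Filter F -> f @ F --> a -> (f t).1 @[t --> F] --> a.1.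
Proof. by move=> FF fa; apply: cvg_comp fa _; exact: cvg_fst. Qed.

Lemma cvg_pair2 (U W : topologicalType) (T : Type) (F : set_system T) (f : T -> U * W) (a : U * W) :
  Filter F -> f @ F --> a -> (f t).2 @[t --> F] --> a.2.
Proof. by move=> FF fa; apply: cvg_comp fa _; exact: cvg_snd. Qed.

Hypotheses (mulc : cvg_closed2 mul) (conjc : cvg_closed1 conj).

(** Continuity passes through Cayley-Dickson doubling; three doublings from the reals give it for
    [omul]. *)
Lemma cd_mul_cvg : @cvg_closed2 (V * V)%type (cd_mul mul conj).
Proof.
move=> T F FF x y a b xa yb.
have x1 := cvg_pair1 FF xa; have x2 := cvg_pair2 FF xa.
have y1 := cvg_pair1 FF yb; have y2 := cvg_pair2 FF yb.
apply: cvg_pair.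
  by apply: cvgB; apply: mulc => //; exact: conjc.
by apply: cvgD; apply: mulc => //; exact: conjc.
Qed.

Lemma cd_conj_cvg : @cvg_closed1 (V * V)%type (cd_conj conj).
Proof.
move=> T F FF x a xa; apply: cvg_pair; first by apply: conjc; exact: cvg_pair1 xa.
by apply: cvgN; exact: cvg_pair2 xa.
Qed.
End CayleyDicksonContinuity.

Section PointwiseLimits.
Variables (R : realType) (V : normedModType R) (T : Type) (F : set_system T).
Hypothesis FF : Filter F.
Implicit Types (f g : T -> V) (r s : T -> R) (a b : V) (p q : R).

Lemma lim_add f g a b : f @ F --> a -> g @ F --> b -> f t + g t @[t --> F] --> a + b.
Proof. exact: cvgD. Qed.
Lemma lim_opp f a : f @ F --> a -> - f t @[t --> F] --> - a.
Proof. exact: cvgN. Qed.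
Lemma lim_sub f g a b : f @ F --> a -> g @ F --> b -> f t - g t @[t --> F] --> a - b.
Proof. exact: cvgB. Qed.
Lemma lim_scale r f p a : r @ F --> p -> f @ F --> a -> r t *: f t @[t --> F] --> p *: a.
Proof. exact: cvgZ. Qed.
Lemma lim_mul r s p q : r @ F --> p -> s @ F --> q -> r t * s t @[t --> F] --> p * q.
Proof. exact: cvgM. Qed.
Lemma lim_inv r p : p != 0 -> r @ F --> p -> (r t)^-1 @[t --> F] --> p^-1.
Proof. exact: cvgV. Qed.
End PointwiseLimits.

Section Continuity.
Variable R : realType.
Local Notation oct := (oct R).
Local Notation J1 := (J1 R).

Lemma nbhs_J1 (Y : J1) : nbhs Y = nbhs (Y : (R * R * R * oct * oct * oct)%type).
Proof. reflexivity. Qed.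

Lemma omul_cvg : cvg_closed2 (@omul R).
Proof.
have m0 : @cvg_closed2 R^o *%R by move=> T F FF x y a b; exact: cvgM.
have c0 : @cvg_closed1 R^o id by [].
have c1 := cd_conj_cvg c0; have c2 := cd_conj_cvg c1.
exact: cd_mul_cvg (cd_mul_cvg (cd_mul_cvg m0 c0) c1) c2.
Qed.

Lemma oconj_cvg : cvg_closed1 (@oconj R).
Proof.
have c0 : @cvg_closed1 R^o id by [].
exact: cd_conj_cvg (cd_conj_cvg (cd_conj_cvg c0)).
Qed.

Section Limits.
Variables (T : Type) (F : set_system T).
Context {FF : Filter F}.

Lemma odot_cvg (x y : T -> oct) a b : x @ F --> a -> y @ F --> b ->
  odot (x t) (y t) @[t --> F] --> odot a b.
Proof.
move=> xa yb; have h := omul_cvg FF xa (oconj_cvg FF yb).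
have h3 := cvg_pair1 FF (cvg_pair1 FF (cvg_pair1 FF h)).
with_strategy transparent [odot] (exact: h3).
Qed.

Lemma h1_cvg (a1 a2 a3 : T -> R) (x1 x2 x3 : T -> oct) b1 b2 b3 y1 y2 y3 :
  a1 @ F --> b1 -> a2 @ F --> b2 -> a3 @ F --> b3 ->
  x1 @ F --> y1 -> x2 @ F --> y2 -> x3 @ F --> y3 ->
  h1 (a1 t) (a2 t) (a3 t) (x1 t) (x2 t) (x3 t) @[t --> F] --> h1 b1 b2 b3 y1 y2 y3.
Proof.
move=> c1 c2 c3 c4 c5 c6.
exact: (cvg_pair (cvg_pair (cvg_pair (cvg_pair (cvg_pair c1 c2) c3) c4) c5) c6).
Qed.

Lemma J1_cvg (X : T -> J1) (Y : J1) : X @ F --> Y ->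
  [/\ (X t).1.1.1.1.1 @[t --> F] --> Y.1.1.1.1.1,
      (X t).1.1.1.1.2 @[t --> F] --> Y.1.1.1.1.2 &
      (X t).1.1.1.2 @[t --> F] --> Y.1.1.1.2] /\
  [/\ (X t).1.1.2 @[t --> F] --> Y.1.1.2,
      (X t).1.2 @[t --> F] --> Y.1.2 & (X t).2 @[t --> F] --> Y.2].
Proof.
rewrite nbhs_J1 => h; have c5 := cvg_pair1 FF h; have c4 := cvg_pair1 FF c5.
have c3 := cvg_pair1 FF c4; have c2 := cvg_pair1 FF c3.
split; split; [exact: (cvg_pair1 FF c2)|exact: (cvg_pair2 FF c2)|exact: (cvg_pair2 FF c3)
  |exact: (cvg_pair2 FF c4)|exact: (cvg_pair2 FF c5)|exact: (cvg_pair2 FF h)].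
Qed.

Lemma kmapE_proj c (b : oct) (X : J1) : kmap c b X =
  h1 X.1.1.1.1.1
     (c ^+ 2 * X.1.1.1.1.2 + odot b b * X.1.1.1.2 + 2 * c * odot b X.1.1.2)
     (odot b b * X.1.1.1.1.2 + c ^+ 2 * X.1.1.1.2 - 2 * c * odot b X.1.1.2)
     (X.1.1.2 - (2 * odot b X.1.1.2 + c * (X.1.1.1.1.2 - X.1.1.1.2)) *: b)
     (c *: X.1.2 - oconj (omul X.2 b)) (c *: X.2 + oconj (omul b X.1.2)).
Proof. by have [a1 [a2 [a3 [x1 [x2 [x3 ->]]]]]] := J1P X. Qed.

Lemma kmap_cvg (c : T -> R) (b : T -> oct) (X : T -> J1) c0 b0 X0 :
  c @ F --> c0 -> b @ F --> b0 -> X @ F --> X0 ->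
  kmap (c t) (b t) (X t) @[t --> F] --> kmap c0 b0 X0.
Proof.
move=> cc bb /J1_cvg[[h1c h2c h3c] [h4c h5c h6c]].
rewrite kmapE_proj; under eq_cvg do rewrite kmapE_proj.
have bbc := odot_cvg bb bb; have bxc := odot_cvg bb h4c.
have c2c : c t ^+ 2 @[t --> F] --> c0 ^+ 2 by apply: cvgM.
have cst2 : (fun=> 2 : R) @ F --> (2 : R) by exact: cvg_cst.
have cbx := lim_mul FF (lim_mul FF cst2 cc) bxc.
have e2 := lim_add FF (lim_add FF (lim_mul FF c2c h2c) (lim_mul FF bbc h3c)) cbx.
have e3 := lim_sub FF (lim_add FF (lim_mul FF bbc h2c) (lim_mul FF c2c h3c)) cbx.
have e4 := lim_sub FF h4c
  (lim_scale FF (lim_add FF (lim_mul FF cst2 bxc) (lim_mul FF cc (lim_sub FF h2c h3c))) bb).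
have e5 := lim_sub FF (lim_scale FF cc h5c) (oconj_cvg FF (omul_cvg FF h6c bb)).
have e6 := lim_add FF (lim_scale FF cc h6c) (oconj_cvg FF (omul_cvg FF bb h5c)).
exact: (h1_cvg h1c e2 e3 e4 e5 e6).
Qed.

Lemma onorm_cvg (y : T -> oct) y0 : y @ F --> y0 -> onorm (y t) @[t --> F] --> onorm y0.
Proof. by move=> yc; apply: continuous_cvg (odot_cvg yc yc); exact: sqrt_continuous. Qed.

Lemma ounit_cvg (y : T -> oct) y0 : y0 != 0 -> y @ F --> y0 ->
  ounit (y t) @[t --> F] --> ounit y0.
Proof.
move=> y00 yc; have n0 : onorm y0 != 0 by rewrite gt_eqF // sqrtr_gt0 odot_gt0.
exact: (lim_scale FF (lim_inv FF n0 (onorm_cvg yc)) yc).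
Qed.

Lemma rot3_cvg (y2 y3 : T -> oct) b2 b3 Z : b3 != 0 -> y2 @ F --> b2 -> y3 @ F --> b3 ->
  rot3 (y2 t) (y3 t) Z @[t --> F] --> rot3 b2 b3 Z.
Proof.
move=> b30 c2 c3; have nc := onorm_cvg c3; have uc := ounit_cvg b30 c3.
have k1 := lim_opp FF (oconj_cvg FF (omul_cvg FF c2 uc)).
have k2 := lim_opp FF (oconj_cvg FF uc).
have cst0 : (fun=> 0 : R) @ F --> (0 : R) by exact: cvg_cst.
have cst1 : (fun=> kmap 0 (oone R) Z) @ F --> kmap 0 (oone R) Z by exact: cvg_cst.
exact: (kmap_cvg nc k1 (kmap_cvg cst0 k2 cst1)).
Qed.

Lemma rot2_cvg (y2 y3 : T -> oct) b2 b3 Z : b2 != 0 -> y2 @ F --> b2 -> y3 @ F --> b3 ->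
  rot2 (y2 t) (y3 t) Z @[t --> F] --> rot2 b2 b3 Z.
Proof.
move=> b20 c2 c3; have nc := onorm_cvg c2; have uc := ounit_cvg b20 c2.
have k1 := oconj_cvg FF (omul_cvg FF uc c3).
have k2 := lim_opp FF (oconj_cvg FF uc).
have cst0 : (fun=> 0 : R) @ F --> (0 : R) by exact: cvg_cst.
have cst1 : (fun=> Z) @ F --> Z by exact: cvg_cst.
exact: (kmap_cvg nc k1 (kmap_cvg cst0 k2 cst1)).
Qed.

Lemma coord_cvg (X : T -> J1) (X0 : J1) : X0.1.1.1.1.1 != 0 -> X @ F --> X0 ->
  (- (X t).1.1.1.1.1)^-1 *: (X t).1.2 @[t --> F] --> (- X0.1.1.1.1.1)^-1 *: X0.1.2 /\
  (- (X t).1.1.1.1.1)^-1 *: (X t).2 @[t --> F] --> (- X0.1.1.1.1.1)^-1 *: X0.2.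
Proof.
move=> a0 /J1_cvg[[ac _ _] [_ x2c x3c]].
have na0 : - X0.1.1.1.1.1 != 0 by rewrite oppr_eq0.
have ic := lim_inv FF na0 (lim_opp FF ac).
by split; [exact: (lim_scale FF ic x2c)|exact: (lim_scale FF ic x3c)].
Qed.

Lemma sec3_cvg (X : T -> J1) (X0 Z : J1) : X0.1.1.1.1.1 != 0 -> X0.2 != 0 ->
  X @ F --> X0 -> sec3 (X t) Z @[t --> F] --> sec3 X0 Z.
Proof.
move=> a0 x30 /(coord_cvg a0)[c2 c3].
have y30 : (- X0.1.1.1.1.1)^-1 *: X0.2 != 0.
  by rewrite scaler_eq0 invr_eq0 oppr_eq0 (negbTE a0).
exact: (rot3_cvg y30 c2 c3).
Qed.

Lemma sec2_cvg (X : T -> J1) (X0 Z : J1) : X0.1.1.1.1.1 != 0 -> X0.1.2 != 0 ->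
  X @ F --> X0 -> sec2 (X t) Z @[t --> F] --> sec2 X0 Z.
Proof.
move=> a0 x20 /(coord_cvg a0)[c2 c3].
have y20 : (- X0.1.1.1.1.1)^-1 *: X0.1.2 != 0.
  by rewrite scaler_eq0 invr_eq0 oppr_eq0 (negbTE a0).
exact: (rot2_cvg y20 c2 c3).
Qed.
End Limits.
End Continuity.

(** * Orbit maps *)

Section PointwiseTopology.
Local Open Scope quotient_scope.
Variables (T V : topologicalType) (G : set {ptws V -> V}).

Lemma cvg_to_ptws_set (s : T -> G) (t : T) :
  (forall v, (fun u => (val (s u) : V -> V) v) @ t --> (val (s t) : V -> V) v) ->
  s @ t --> s t.
Proof.
move=> cs A /= [_ [[B oB <-] Bst sBA]].
apply: filterS sBA _.
have : (fun u => val (s u)) @ t --> (val (s t) : {ptws V -> V}).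
  apply/cvg_sup => v C /= [_ [[E oE <-] Est sEC]].
  by apply: filterS sEC _; apply: cs; exact: open_nbhs_nbhs.
by apply; exact: open_nbhs_nbhs.
Qed.

Lemma ptws_set_eval_continuous (v : V) : continuous (fun g : G => (val g : V -> V) v).
Proof.
move=> g; apply: (@continuous_comp G {ptws V -> V} V val (fun f => f v)).
  exact: initial_continuous.
exact: (@proj_continuous V (fun=> V) v).
Qed.
End PointwiseTopology.

Section Rays.
Local Open Scope quotient_scope.
Variable R : realType.
Local Notation oct := (oct R).
Local Notation J1 := (J1 R).
Local Notation P := (@Pminus R).

Lemma ray_val (x : nullcone R) : ray (val x) = \pi_(Fspace R) x.
Proof. by rewrite /ray valKd. Qed.

Lemma ray_eq (X Y : J1) : nullcone R X -> nullcone R Y ->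
  ray X = ray Y <-> exists2 r, 0 < r & Y = r *: X.
Proof.
move=> nX nY; pose x : nullcone R := exist _ X (mem_set nX).
pose y : nullcone R := exist _ Y (mem_set nY).
rewrite -[X]/(val x) -[Y]/(val y) !ray_val.
split=> [/eqmodP/asboolP//|h]; by apply/eqmodP/asboolP.
Qed.

Lemma raysurj (c : Fspace R) : exists2 X, nullcone R X & c = ray X.
Proof.
exists (val (repr c : nullcone R)); first exact: set_mem (valP (repr c : nullcone R)).
by rewrite ray_val reprK.
Qed.

(** The chosen representative differs from X by a positive factor, with which the linear map g
    commutes. *)
Lemma act_ray g (X : J1) : F4 R g -> nullcone R X -> act g (ray X) = ray (g X).
Proof.
move=> Fg nX; rewrite /act; set Y := val _.
have nY : nullcone R Y by exact: set_mem (valP (repr (ray X) : nullcone R)).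
have : ray Y = ray X by rewrite ray_val reprK.
move/(ray_eq nY nX) => [r r0 XE].
apply/(ray_eq (F4_nullcone Fg nY) (F4_nullcone Fg nX)).
by exists r => //; rewrite XE (F4Z _ _ Fg).
Qed.

Lemma act_comp g h (c : Fspace R) : F4 R g -> F4 R h -> act (g \o h) c = act g (act h c).
Proof.
move=> Fg Fh; have [X nX ->] := raysurj c.
by rewrite (act_ray (F4_comp Fg Fh) nX) (act_ray Fh nX) (act_ray Fg (F4_nullcone Fh nX)).
Qed.

Lemma act_id (c : Fspace R) : act id c = c.
Proof. by have [X nX ->] := raysurj c; rewrite act_ray //; exact: F4_id. Qed.
End Rays.

#[local] Opaque act ray.

Section OrbitMaps.
Local Open Scope quotient_scope.
Variable R : realType.
Local Notation oct := (oct R).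
Local Notation J1 := (J1 R).
Local Notation P := (@Pminus R).

Lemma Ksub_inv (k k' : J1 -> J1) : Ksub R k -> cancel k k' -> cancel k' k -> Ksub R k'.
Proof.
move=> Kk kK k'K; have [Fk _] := Kk; split; first exact: F4_inv Fk kK k'K.
apply/funext => X; apply: (can_inj kK).
by rewrite /comp (Ksub_sigma _ Kk) k'K sigmaJK k'K.
Qed.

Lemma Ktrans_ray (c : Fspace R) : exists2 k, Ksub R k & act k (ray P) = c.
Proof.
have [X nX ->] := raysurj c; have [k [r [Kk r0 XE]]] := nullcone_Ktrans nX.
exists k; first exact: Kk.
rewrite (act_ray Kk.1 (nullcone_Pminus R)).
apply/(ray_eq (F4_nullcone Kk.1 (nullcone_Pminus R)) nX); by exists r.
Qed.

Variables G H : set {ptws J1 -> J1}.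
Hypothesis GF : forall g, G g -> F4 R g.
Hypothesis GM : forall g h : J1 -> J1, G g -> G h -> G (g \o h).
Hypothesis GV : forall g g' : J1 -> J1, G g -> cancel g g' -> cancel g' g -> G g'.
Hypothesis KG : forall g, Ksub R g -> G g.
Hypothesis HE : forall g, H g <-> G g /\ act g (ray P) = ray P.

Let orb (g : G) : Fspace R := act (val g) (ray P).

Let GP (g : G) : G (val g). Proof. exact: set_mem (valP g). Qed.

Let coset_eq (g h : G) : (lcoset H g = lcoset H h) <-> orb g = orb h.
Proof.
have sub (g1 g2 : G) : orb g1 = orb g2 ->
    [set val g1 \o x | x in H] `<=` [set val g2 \o x | x in H].
  move=> e f [x Hx <-]; have [Gx xP] := (HE x).1 Hx.
  have [_ b2 _] := GF (GP g2); have [g2' [gK g'K]] := bij_inv b2.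
  have G2' := GV (GP g2) gK g'K; have Gy := GM G2' (GP g1).
  (* The element g2^-1 g1 x stabilizes the base ray, since g1 and g2 have the same orbit point. *)
  exists ((g2' \o val g1) \o x); last by apply/funext => X; rewrite /comp g'K.
  apply/HE; split; first exact: GM.
  rewrite (act_comp _ (GF Gy) (GF Gx)) xP (act_comp _ (GF G2') (GF (GP g1))).
  rewrite -[act (val g1) _]/(orb g1) e -(act_comp _ (GF G2') (GF (GP g2))).
  rewrite -[RHS]act_id; congr (act _ _); exact/funext.
split=> [/eqmodP/asboolP e|e]; last first.
  by apply/eqmodP/asboolP; apply/seteqP; split; [exact: (sub _ _ e)|exact: (sub _ _ (esym e))].
have H1 : H id.
  by apply/HE; split; [apply: KG; split; [exact: F4_id|exact/funext/sigmaJK]|exact: act_id].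
have : [set val h \o x | x in H] (val g) by rewrite -e; exists id.
move=> [x Hx xE]; have [Gx xP] := (HE x).1 Hx.
have e1 := congr1 (fun f : J1 -> J1 => act f (ray P)) xE.
have e2 := act_comp (ray P) (GF (GP h)) (GF Gx).
exact: (etrans (esym e1) (etrans e2 (congr1 (act (val h)) xP))).
Qed.

Let orb_surj (c : Fspace R) : exists g : G, orb g = c.
Proof.
have [k Kk kE] := Ktrans_ray c.
by exists (exist _ k (mem_set (KG Kk))).
Qed.

Let orb_continuous : continuous orb.
Proof.
pose e (g : G) : nullcone R :=
  exist _ (val g P) (mem_set (F4_nullcone (GF (GP g)) (nullcone_Pminus R))).
have -> : orb = \pi_(Fspace R) \o e.
  apply/funext => g; rewrite /orb (act_ray (GF (GP g)) (nullcone_Pminus R)).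
  by rewrite -[val g P]/(val (e g)) ray_val.
have ec : continuous e.
  apply: continuous_comp_initial; exact: (@ptws_set_eval_continuous _ G P).
by move=> g; apply: continuous_comp; [exact: ec|exact: pi_continuous].
Qed.

Let nullcone_neg (x : nullcone R) : (val x : J1).1.1.1.1.1 != 0.
Proof.
have := set_mem (valP x); have [a1 [a2 [a3 [x1 [x2 [x3 ->]]]]]] := J1P (val x).
by case/nullconeE => _ a10; rewrite lt_eqF.
Qed.

Let nullcone_x23 (x : nullcone R) : (val x : J1).2 != 0 \/ (val x : J1).1.2 != 0.
Proof.
have := set_mem (valP x); have [a1 [a2 [a3 [x1 [x2 [x3 ->]]]]]] := J1P (val x) => nX.
have [x30|] := eqVneq x3 0; last by left.
have [x20|] := eqVneq x2 0; last by right.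
have := nullcone_sphere nX; rewrite x20 x30 !scaler0 !odotE /= => /eqP.
by rewrite !mulr0 !addr0 eq_sym oner_eq0.
Qed.

Let sec_orb (s : J1 -> J1 -> J1) (x : nullcone R) (Ks : Ksub R (s (val x))) :
  - (val x : J1).1.1.1.1.1 *: s (val x) P = val x ->
  orb (exist _ (s (val x)) (mem_set (KG Ks))) = \pi_(Fspace R) x.
Proof.
move=> e; rewrite /orb /= (act_ray Ks.1 (nullcone_Pminus R)) -ray_val.
have nX := set_mem (valP x).
apply/(ray_eq (F4_nullcone Ks.1 (nullcone_Pminus R)) nX).
exists (- (val x : J1).1.1.1.1.1); last exact: esym e.
move: nX; have [a1 [a2 [a3 [x1 [x2 [x3 ->]]]]]] := J1P (val x).
by case/nullconeE => _; rewrite oppr_gt0.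
Qed.

(** [s] is an arbitrary choice of preimages without any continuity. Near x, the element [s] of a ray
    and the local section [sec] lie in the same coset, and the coset of [sec] varies
    continuously. *)
Let sec_coset_cvg (sec : J1 -> J1 -> J1) (s : Fspace R -> G) (x : nullcone R) :
  (forall c, orb (s c) = c) ->
  (\forall y \near x, Ksub R (sec (val y)) /\
    - (val y : J1).1.1.1.1.1 *: sec (val y) P = val y) ->
  (forall Z, sec (val y) Z @[y --> x] --> sec (val x) Z) ->
  lcoset H (s (\pi_(Fspace R) y)) @[y --> x] --> lcoset H (s (\pi_(Fspace R) x)).
Proof.
move=> sE good cs; have Kid : Ksub R id by split; [exact: F4_id|exact/funext/sigmaJK].
(* [sec] made total with values in G: the identity is a default where [sec] leaves K, and only the
   values near x matter. *)
pose t (y : nullcone R) : G := if pselect (Ksub R (sec (val y))) is left K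
  then exist _ (sec (val y)) (mem_set (KG K)) else exist _ id (mem_set (KG Kid)).
have tE y : Ksub R (sec (val y)) -> val (t y) = sec (val y).
  by rewrite /t; case: pselect.
have tS y : Ksub R (sec (val y)) /\ - (val y : J1).1.1.1.1.1 *: sec (val y) P = val y ->
    lcoset H (s (\pi_(Fspace R) y)) = lcoset H (t y).
  move=> [K e]; apply/coset_eq; rewrite sE /t; case: pselect => // K'.
  by rewrite (sec_orb K' e).
have good_x := nbhs_singleton good.
rewrite (tS x good_x).
have tc : t @ x --> t x.
  apply: cvg_to_ptws_set => Z; rewrite (tE x good_x.1).
  apply: (cvg_trans _ (cs Z)); apply: (@near_eq_cvg _ _ (nbhs x) (nbhs_filter x)); near=> y.
  suff [K _] : Ksub R (sec (val y)) /\
    - (val y : J1).1.1.1.1.1 *: sec (val y) P = val y by rewrite (tE y K).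
  by near: y; exact: good.
apply: (@cvg_trans _ (lcoset H (t y) @[y --> x])); last first.
  by apply: (cvg_comp _ _ tc); exact: pi_continuous.
by apply: (@near_eq_cvg _ _ (nbhs x) (nbhs_filter x)); near=> y;
  apply/esym/tS; near: y; exact: good.
Unshelve. all: by end_near.
Qed.

Let val_cvg (x : nullcone R) : (val y : J1) @[y --> x] --> (val x : J1).
Proof. exact: initial_continuous. Qed.

(** Used for F4 with MAN^+ and for K with M. All local sections take values in K, hence in both
    groups, so one argument gives the continuity of both inverses. *)
Lemma orbit_homeo_exists : exists phi : coset_space G H -> Fspace R, orbit_homeo phi.
Proof.
have [s sE] := choice orb_surj.
pose phi (c : coset_space G H) : Fspace R := orb (repr c).
have phiE g : phi (lcoset H g) = orb g by apply/coset_eq; rewrite /lcoset reprK.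
exists phi; split.
- exists (fun c => lcoset H (s c)); split.
  + apply/quotient_continuous.
    have -> : phi \o \pi_(coset_space G H) = orb by apply/funext => g; exact: phiE.
    exact: orb_continuous.
  + apply/quotient_continuous => x; have vc := @val_cvg x.
    have [_ [_ x2c x3c]] := J1_cvg vc; have a0 := nullcone_neg x.
    (* Nonvanishing of x3 or x2 persists near x, so the corresponding section is valid on a whole
       neighbourhood. *)
    case: (nullcone_x23 x) => x0.
    * apply: (sec_coset_cvg (sec := @sec3 R) sE) => [|Z]; last exact: sec3_cvg a0 x0 vc.
      apply: (filterS _ (cvgr_neq0 _ x3c x0)) => y.
      have := set_mem (valP y).
      have [a1 [a2 [a3 [x1 [x2 [x3 ->]]]]]] := J1P (val y) => nX; exact: sec3P nX.
    * apply: (sec_coset_cvg (sec := @sec2 R) sE) => [|Z]; last exact: sec2_cvg a0 x0 vc.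
      apply: (filterS _ (cvgr_neq0 _ x2c x0)) => y.
      have := set_mem (valP y).
      have [a1 [a2 [a3 [x1 [x2 [x3 ->]]]]]] := J1P (val y) => nX; exact: sec2P nX.
  + by move=> c; rewrite -[RHS]reprK; apply/coset_eq; rewrite sE.
  + by move=> c; rewrite phiE sE.
- exact: phiE.
- move=> g h gh ghE; rewrite !phiE /orb ghE.
  by rewrite (act_comp _ (GF (GP g)) (GF (GP h))).
Qed.
End OrbitMaps.

(** * Stabilizers of the base ray in the full group and in K *)

Section Stabilizers.
Variable R : realType.
Local Notation J1 := (J1 R).
Local Notation P := (@Pminus R).

Lemma fix_ray (g : J1 -> J1) : F4 R g ->
  act g (ray P) = ray P <-> exists2 r, 0 < r & g P = r *: P.
Proof.
move=> Fg; have nP := nullcone_Pminus R; have ngP := F4_nullcone Fg nP.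
rewrite (act_ray Fg nP); split=> [/esym/(ray_eq nP ngP) //|h].
by apply/esym/(ray_eq nP ngP).
Qed.

Lemma MANplus_stab (g : J1 -> J1) :
  MANplus R g <-> F4 R g /\ act g (ray P) = ray P.
Proof.
split=> [/MANplus_F4[Fg h]|[Fg /(fix_ray Fg)[r r0 gP]]].
  by split; [exact: Fg|exact/(fix_ray Fg)].
exact: (stab_MANplus Fg r0 gP).
Qed.

Lemma Msub_stab (k : J1 -> J1) :
  Msub R k <-> Ksub R k /\ act k (ray P) = ray P.
Proof.
split=> [Mk|[Kk /(fix_ray Kk.1)[r r0 kP]]]; last exact: (Ksub_stab_Msub Kk kP).
have [Kk _] := Mk; split; first exact: Kk.
by apply/(fix_ray Kk.1); exists 1; [exact: ltr01|rewrite scale1r; exact: Msub_Pminus].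
Qed.
End Stabilizers.

Theorem theorem9p5 (R : realType) :
  [/\ forall g X, F4 R g -> nullcone R X ->
        nullcone R (g X) /\ act g (ray X) = ray (g X),
      [set g | F4 R g /\ act g (ray Pminus) = ray Pminus] = MANplus R,
      exists phi : coset_space (F4 R) (MANplus R) -> Fspace R, orbit_homeo phi,
      [set act k (ray Pminus) | k in Ksub R] = setT
    & exists psi : coset_space (Ksub R) (Msub R) -> Fspace R, orbit_homeo psi].
Proof.
split.
- by move=> g X Fg nX; split; [exact: F4_nullcone|exact: act_ray].
- by apply/seteqP; split=> g /MANplus_stab.
- apply: orbit_homeo_exists.
  + by [].
  + by move=> g h; exact: F4_comp.
  + by move=> g g'; exact: F4_inv.
  + by move=> g [].
  + exact: MANplus_stab.
- apply/seteqP; split=> // c _; have [k Kk kE] := Ktrans_ray c.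
  by exists k; [exact: Kk|exact: kE].
- apply: orbit_homeo_exists.
  + by move=> g [].
  + by move=> g h; exact: Ksub_comp.
  + by move=> g g'; exact: Ksub_inv.
  + by [].
  + exact: Msub_stab.
Qed.
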